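(* Let $|\kappa|>\frac12$. Let $\lambda\in\operatorname{spec}(\mathcal A_\kappa)$ and let $u\in\operatorname{dom}(\mathcal A_\kappa)$ be an associated eigenfunction, $\mathcal A_\kappa u=\lambda u$, with $\|u\|=1$. For $h=\pi/n$ ($n\in\mathbb N$, $n\ge4$) let $u_h$ be the nodal interpolant of $u$ in $\mathcal L_h$. (a) If $|\kappa|>\frac32$ or $|\kappa|=1$, then there exists a constant $c>0$ such that for every such $h$ \[ \|u-u_h\|+\|\mathcal A_\kappa u-\mathcal A_\kappa u_h\|\le c\,h . \] (b) If $|\kappa|\in\left(\frac12,\frac32\right]\setminus\{1\}$ and $r<|\kappa|-\frac12$, then there exists a constant $c>0$ such that for every such $h$ \[ \|u-u_h\|+\|\mathcal A_\kappa u-\mathcal A_\kappa u_h\|\le c\,h^{r}. \]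
   Context: $\kappa$ is a real parameter, and $V=[v_{ij}]_{i,j=1}^2$ is a hermitian matrix potential on $[0,\pi]$ all of whose entries are complex analytic functions in a neighbourhood of $[0,\pi]$. Consider the differential expression on $(0,\pi)$ \[ \mathfrak A_\kappa=\begin{pmatrix}0&\frac{d}{d\theta}+\frac{\pi\kappa}{\theta(\pi-\theta)}\\ -\frac{d}{d\theta}+\frac{\pi\kappa}{\theta(\pi-\theta)}&0\end{pmatrix}+V(\theta). \] $L_2(0,\pi)^2$ is the Hilbert space of square integrable functions $u:(0,\pi)\to\mathbb C^2$ with norm $\|u\|=(\int_0^\pi|u(\theta)|^2\,d\theta)^{1/2}$. The operator $\mathcal A_\kappa$ is the maximal operator of $\mathfrak A_\kappa$ in $L_2(0,\pi)^2$: $\operatorname{dom}(\mathcal A_\kappa)=\{\Psi\in L_2(0,\pi)^2:\mathfrak A_\kappa\Psi\in L_2(0,\pi)^2\}$ and $\mathcal A_\kappa\Psi=\mathfrak A_\kappa\Psi$. For $|\kappa|\ge\frac12$ it is self-adjoint with compact resolvent, so its spectrum consists of eigenvalues. For $n\in\mathbb N$, $n\ge4$, set $h=\pi/n$ and $\theta_j=j\pi/n$, $j=0,\dots,n$. $\mathcal L_h$ is the space of continuous functions $[0,\pi]\to\mathbb C^2$ that vanish at $0$ and $\pi$ and are affine on each segment $[\theta_j,\theta_{j+1}]$; it is a subspace of $\operatorname{dom}(\mathcal A_\kappa)$. The nodal interpolant $u_h$ of $u$ is the unique element of $\mathcal L_h$ with $u_h(\theta_j)=u(\theta_j)$ for $j=1,\dots,n-1$.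 *)

(* Defs.v *)
(* C^2 is ['cV[R[i]]_2]; the components psi_1, psi_2 have the indices
   [ord0], [ord_max] of ['I_2].  Functions on (0,pi) or [0,pi] are total
   functions on R whose values elsewhere never matter. *)
From HB Require Import structures.
From mathcomp Require Import all_boot all_order all_algebra.
From mathcomp Require Import spectral.
From mathcomp Require Import complex.
From mathcomp Require Import all_classical all_reals all_analysis.
Set Implicit Arguments.
Unset Strict Implicit.
Unset Printing Implicit Defensive.
Import Order.TTheory GRing.Theory Num.Theory.
Import numFieldNormedType.Exports.
Local Open Scope classical_set_scope.
Local Open Scope ring_scope.
Local Open Scope complex_scope.

Section Defs.
Context {R : realType}.
Implicit Types (u f : R -> 'cV[R[i]]_2) (V : R[i] -> 'M[R[i]]_2).

Local Notation mu := (@lebesgue_measure R).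

(* [R[i]^o] is [R[i]] with the topology of its absolute value. *)
Definition analytic_at (v : R[i] -> R[i]) (z0 : R[i]) : Prop :=
  exists a : nat -> R[i],
    \forall z \near (z0 : R[i]^o),
      series (fun k => a k * (z - z0) ^+ k : R[i]^o) @ \oo --> (v z : R[i]^o).

Definition analytic_hermitian_potential V : Prop :=
  (exists U : set R[i]^o,
     [/\ open U,
         forall x : R, 0 <= x <= pi -> U x%:C
       & forall i j z, U z -> analytic_at (fun w => V w i j) z]) /\
  (forall x : R, 0 <= x <= pi -> V x%:C \is hermsymmx).

Definition real_parts (P : (R -> R) -> Prop) u : Prop :=
  forall i : 'I_2, P (fun x => complex.Re (u x i ord0)) /\
                   P (fun x => complex.Im (u x i ord0)).

(* Extended-real valued, so that it is +oo when u is not square integrable. *)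
Definition L2norm u : \bar R :=
  ((\int[mu]_(x in `]0%R, pi[)
      (\sum_(i < 2) complex.Re `|u x i ord0| ^+ 2)%:E) `^ 2^-1)%E.

Definition in_L2 u : Prop :=
  real_parts (measurable_fun `]0, pi[) u /\ (L2norm u < +oo)%E.

(* Local absolute continuity on (0,pi): being an indefinite Lebesgue integral
   of a locally integrable function. *)
Definition loc_abs_cont (f : R -> R) : Prop :=
  exists g : R -> R, forall a b : R, 0 < a -> a <= b -> b < pi ->
    mu.-integrable `[a, b] (EFin \o g) /\
    f b - f a = \int[mu]_(x in `[a, b]) g x.

Definition cderive (f : R -> R[i]) (x : R) : R[i] :=
  derive1 (fun y => complex.Re (f y)) x +i* derive1 (fun y => complex.Im (f y)) x.

(* For locally absolutely continuous u the derivatives exist almost everywhere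
   on (0,pi), so that this is meaningful up to a null set. *)
Definition diff_expr (kappa : R) V u (x : R) : 'cV[R[i]]_2 :=
  let w := (pi * kappa / (x * (pi - x)))%:C in
  let u1 := fun y => u y ord0 ord0 in
  let u2 := fun y => u y ord_max ord0 in
  (\col_(i < 2) if i == ord0 then cderive u2 x + w * u2 x
                else - cderive u1 x + w * u1 x)
  + V x%:C *m u x.

(* Elements of the domain are represented by their (unique) locally absolutely
   continuous representative, so they have well-defined values on (0,pi). *)
Definition in_dom (kappa : R) V u : Prop :=
  [/\ in_L2 u, real_parts loc_abs_cont u & in_L2 (diff_expr kappa V u)].

Definition in_resolvent_set (kappa : R) V (lambda : R[i]) : Prop :=
  (forall f, in_L2 f -> exists2 u, in_dom kappa V u &
     (fun x => diff_expr kappa V u x - lambda *: u x)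
       = f %[ae mu in `]0, pi[%classic]) /\
  (exists M : R, forall u, in_dom kappa V u ->
     (L2norm u <=
        M%:E * L2norm (fun x => diff_expr kappa V u x - lambda *: u x)%R)%E).

Definition in_spec (kappa : R) V (lambda : R[i]) : Prop :=
  ~ in_resolvent_set kappa V lambda.

Definition node (n j : nat) : R := j%:R * pi / n%:R.

Definition in_Lh (n : nat) (v : R -> 'cV[R[i]]_2) : Prop :=
  [/\ real_parts (fun f : R -> R => {within `[0, pi], continuous f}) v,
      v 0 = 0, v pi = 0
    & forall j : nat, (j < n)%N -> exists a b : 'cV[R[i]]_2,
        forall x : R, node n j <= x <= node n j.+1 -> v x = a + x%:C *: b].

Definition nodal_interpolant (n : nat) u (v : R -> 'cV[R[i]]_2) : Prop :=
  in_Lh n v /\ forall j : nat, (0 < j < n)%N -> v (node n j) = u (node n j).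

Definition interp_error (kappa : R) V u (v : R -> 'cV[R[i]]_2) : \bar R :=
  (L2norm (fun x => u x - v x)%R +
   L2norm (fun x => diff_expr kappa V u x - diff_expr kappa V v x)%R)%E.

End Defs.

(* Main.v *)
Require Import Defs.
From HB Require Import structures.
From mathcomp Require Import all_boot all_order all_algebra.
From mathcomp Require Import spectral.
From mathcomp Require Import complex.
From mathcomp Require Import all_classical all_reals all_analysis.
From mathcomp Require Import measurable_realfun ring lra.
Import Order.TTheory GRing.Theory Num.Theory.
Import numFieldNormedType.Exports.
Local Open Scope classical_set_scope.
Local Open Scope ring_scope.
Local Open Scope complex_scope.
Set Implicit Arguments.
Unset Strict Implicit.
Unset Printing Implicit Defensive.

(** The estimate comes from the behaviour of the eigenfunction [u] at the two
    ends of the interval; inside, the derivative of [u] is Lipschitz and that of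
    an affine interpolant is within [O(h)] of it.

    Write [F] for the four real functions Re u_1, Im u_1, Re u_2, Im u_2.  The
    eigenvalue equation, solved for the derivatives, says that [F] solves
      [F_i' = s_i (1/x + 1/(pi-x)) F_i + sum_j B_ij F_j]
    with [s_i = kappa] or [s_i = - kappa] and with [B] bounded and Lipschitz
    (power series expansions and compactness, [potential_lipschitz]).  It holds
    almost everywhere by definition; since [F] is an indefinite integral, it
    then holds everywhere ([eigenfunction_system]).

    Near 0, put [al = `|kappa|].  The equation bounds the derivative of
    [x * F_i x ^+ 2] by the integrand of the L2 norm, so square integrability
    alone gives [F = O(x `^ (- 1/2))] ([energy_bound]).  As [al > 1/2], this
    excludes the solutions of size [x `^ (- al)], and going round the system, one
    power at a time, improves the bound to [F = O(x `^ al)]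
    ([square_integrable_power_bounded]).  Hence [F' = O(x `^ (al - 1))], and [F']
    has Lipschitz constant [O(x `^ (al - 2))] locally
    ([derivative_lipschitz_power]); for [al = 1] the leading term is linear and
    [F'] is Lipschitz up to 0 ([derivative_lipschitz]).  Reflection at [pi / 2]
    turns the other end into the same problem ([mesh_error_right_end]).

    On a mesh interval away from 0, the error [e = F - F_h] vanishes at the left
    node and [e'] is an increment of [F'], so that both [e'] and [e / x] are at
    most [h * O(x `^ (al - 2))].  On the first interval [F'], [F / x] and the
    slope of [F_h] are separately [O(x `^ (al - 1) + h `^ (al - 1))].  In either
    case the errors are [O(h `^ r * x `^ (- sg))] as soon as [0 <= r <= 1], [0 <= sg] and
    [r + 1 - sg <= al] ([mesh_error_power]).  The weight [x `^ (- sg)] is square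
    integrable for [sg < 1/2], and the error in the graph norm is
    [O(h `^ r)] ([interp_error_rate]).  The condition on [r] and [sg] allows
    [r = 1] for [al > 3/2] and every [r < al - 1/2] for [al <= 3/2]; for [al = 1]
    the Lipschitz bound gives [r = 1] with [sg = 0]. *)

(** * Powers and comparison of derivatives *)
Section Calculus.
Context {R : realType}.
Implicit Types (f g df dg : R -> R).

Lemma powRDpos (x a b : R) : 0 < x -> x `^ (a + b) = x `^ a * x `^ b.
Proof. by move=> x0; rewrite powRD// (gt_eqF x0) implybT. Qed.

Lemma powRNpos (x a : R) : 0 < x -> x `^ a * x `^ (- a) = 1.
Proof. by move=> x0; rewrite -powRDpos// subrr powRr0. Qed.

Lemma powR_mulr (x a : R) : 0 < x -> x `^ a * x = x `^ (a + 1).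
Proof. by move=> x0; rewrite powRDpos// powRr1// ltW. Qed.

Lemma ler_powR_exp (c x a b : R) : 0 < x -> x <= c -> a <= b ->
  x `^ b <= c `^ (b - a) * x `^ a.
Proof.
move=> x0 xc ab; have -> : x `^ b = x `^ (b - a) * x `^ a by rewrite -powRDpos// subrK.
rewrite ler_wpM2r ?powR_ge0// ge0_ler_powR ?subr_ge0// nnegrE ltW//.
exact: lt_le_trans xc.
Qed.

Lemma ler_powR_neg (x y a : R) : 0 < x -> x <= y -> a <= 0 -> y `^ a <= x `^ a.
Proof.
move=> x0 xy a0; have y0 : 0 < y by exact: lt_le_trans xy.
rewrite -(opprK a) !(powRN _ (- a)) lef_pV2 ?posrE ?powR_gt0//.
by rewrite ge0_ler_powR ?oppr_ge0// nnegrE ltW.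
Qed.

(** The mean value theorem in comparison form; integrating a bound on a derivative
    amounts to exhibiting a primitive [g] of that bound. *)
Lemma le_increment f g df dg (a b : R) : a <= b ->
  (forall x, a <= x <= b -> is_derive x 1 f (df x)) ->
  (forall x, a <= x <= b -> is_derive x 1 g (dg x)) ->
  (forall x, a <= x <= b -> `|df x| <= dg x) ->
  `|f b - f a| <= g b - g a.
Proof.
move=> ab Hf Hg H.
have key (e : bool) : (-1) ^+ e * (f b - f a) <= g b - g a.
  have D x : a <= x <= b ->
      is_derive x 1 (g - (-1) ^+ e *: f) (dg x - (-1) ^+ e * df x).
    by move=> xab; have := Hf _ xab; have := Hg _ xab => ? ?; exact: is_deriveB.
  have [||z zab] := MVT_segment (f := g - (-1) ^+ e *: f)
    (df := fun x => dg x - (-1) ^+ e * df x) ab.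
  - by move=> x; rewrite in_itv/= => /andP[ax xb]; apply: D; rewrite !ltW.
  - apply: derivable_within_continuous => x; rewrite in_itv/= => xab.
    by have [] := D x xab.
  move: zab; rewrite in_itv/= => zab.
  rewrite !fctE /= /GRing.scale/= => E.
  have : 0 <= (dg z - (-1) ^+ e * df z) * (b - a).
    rewrite mulr_ge0 ?subr_ge0// (le_trans _ (H _ zab))//.
    by rewrite (le_trans (ler_norm _))// normrM normr_sign mul1r.
  by rewrite -E; lra.
have := key false; have := key true; rewrite expr0 expr1 => k1 k2.
by rewrite ler_norml; lra.
Qed.

Lemma is_derive_scaled_powR (k a x : R) : 0 < x -> a != 0 ->
  is_derive x 1 (fun y => k / a * y `^ a) (k * x `^ (a - 1)).
Proof.
move=> x0 a0; have := is_derive1_powR a x0 => D.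
have D2 : is_derive x 1 (fun y => k / a * y `^ a) (k / a *: (a * x `^ (a - 1)))
  by exact: is_deriveZ.
by apply: (is_derive_eq D2); rewrite /GRing.scale/= mulrA divfK.
Qed.

Lemma is_derive_mulc (k x : R) : is_derive x 1 (fun y => k * y) k.
Proof.
have D : is_derive x 1 (fun y => k * y) (k *: 1) := is_deriveZ k (is_derive_id x 1).
by apply: (is_derive_eq D); rewrite /GRing.scale/= mulr1.
Qed.

Lemma is_derive_reflect f (c x l : R) : is_derive (c - x) 1 f l ->
  is_derive x 1 (fun y => f (c - y)) (- l).
Proof.
move=> Df; have Dg : is_derive x 1 (fun y => c - y) (-1).
  have D : is_derive x 1 (fun y => c - y) _ :=
    is_deriveB (is_derive_cst c x 1) (is_derive_id x 1).
  by apply: (is_derive_eq D); rewrite sub0r.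
have D : is_derive x 1 (fun y => f (c - y)) _ :=
  @is_derive1_comp _ f (fun y => c - y) x _ _ Df Dg.
by apply: (is_derive_eq D); rewrite /GRing.scale/=; ring.
Qed.

End Calculus.

(** * Singular first-order systems *)
Section SingularSystem.
Context {R : realType} (T : finType).
Context (F : T -> R -> R) (s : T -> R) (B : T -> T -> R -> R) (al c K : R).
Context (c0 : 0 < c) (al2 : 1 / 2 < al).
Context (sal : forall i, s i = al \/ s i = - al).
Context (dF : forall i x, 0 < x <= c ->
  is_derive x 1 (F i) (s i / x * F i x + \sum_j B i j x * F j x)).
Context (bB : forall i j x, 0 < x <= c -> `|B i j x| <= K).

Let K0 (i : T) : 0 <= K.
Proof. by apply: le_trans (bB i i (x := c) _); rewrite ?normr_ge0// c0 lexx. Qed.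

Definition power_bounded (g : R) :=
  exists2 C, 0 <= C & forall i x, 0 < x <= c -> `|F i x| <= C * x `^ g.

Lemma power_boundedW (g g' : R) : g <= g' -> power_bounded g' -> power_bounded g.
Proof.
move=> gg [C C0 H]; exists (C * c `^ (g' - g)); first by rewrite mulr_ge0 ?powR_ge0.
move=> i x xc; apply: le_trans (H _ _ xc) _; rewrite -mulrA ler_wpM2l//.
by case/andP: xc => x0 xc; exact: ler_powR_exp.
Qed.

Lemma coupling_le i x (M : R) : 0 < x <= c -> (forall j, `|F j x| <= M) ->
  `|\sum_j B i j x * F j x| <= K * #|T|%:R * M.
Proof.
move=> xc H; apply: le_trans (ler_norm_sum _ _ _) _.
apply: (@le_trans _ _ (\sum_(j : T) K * M)).
  by apply: ler_sum => j _; rewrite normrM ler_pM// bB.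
by rewrite sumr_const mulrAC mulr_natr.
Qed.

(** The integrating factor [x `^ (- s i)] removes the singular term, so that only
    the coupling with the other components drives the product. *)
Lemma is_derive_twisted i x : 0 < x <= c ->
  is_derive x 1 (fun y => y `^ (- s i) * F i y)
                (x `^ (- s i) * \sum_j B i j x * F j x).
Proof.
move=> xc; have x0 : 0 < x by case/andP: xc.
have D1 := is_derive1_powR (- s i) x0; have D2 := dF i xc.
have D : is_derive x 1 (fun y => y `^ (- s i) * F i y) _ := is_deriveM D1 D2.
apply: (is_derive_eq D); rewrite /GRing.scale/= powRDpos// powR_inv1 ?ltW//.
by field; rewrite gt_eqF.
Qed.

(** Multiplying [F i ^+ 2] by [x] turns the singular coefficient into a bounded
    one, so that the derivative of [x * F i x ^+ 2] is controlled by the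
    integrand of the L^2-norm alone. *)
Lemma energy_bound (Phi : R -> R) :
  (forall x, 0 < x <= c -> is_derive x 1 Phi (\sum_i F i x ^+ 2)) ->
  (forall x, 0 < x <= c -> 0 <= Phi x) -> power_bounded (- (1 / 2)).
Proof.
move=> dPhi Phi0; have al2' := al2; have c0' := c0.
pose Q := 1 + 2 * al + 2 * c * (K * #|T|%:R).
pose M i := Q * Phi c + c * F i c ^+ 2.
have key i x : 0 < x <= c -> x * F i x ^+ 2 <= M i.
  move=> xc; have Kp : 0 <= K := K0 i.
  have /andP[x0 xc'] := xc.
  have Q0 : 0 <= Q by rewrite /Q !addr_ge0// !mulr_ge0//; lra.
  pose f := fun y => y * F i y ^+ 2; pose g1 := fun y => Q * Phi y.
  have : `|f c - f x| <= g1 c - g1 x.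
    apply: (@le_increment R f g1
      (fun y => F i y ^+ 2 + y * (2 * F i y *
         (s i / y * F i y + \sum_j B i j y * F j y)))
      (fun y => Q * (\sum_j F j y ^+ 2)) x c xc').
    - move=> y /andP[xy yc]; have y0 : 0 < y by exact: lt_le_trans xy.
      have yc0 : 0 < y <= c by rewrite y0.
      have D2 := dF i yc0.
      have D : is_derive y 1 (fun y => y * F i y ^+ 2) _
        := is_deriveM (is_derive_id y 1) (is_deriveX 2 D2).
      by apply: (is_derive_eq D); rewrite /GRing.scale/= expr1 fctE; ring.
    - move=> y /andP[xy yc]; have y0 : 0 < y by exact: lt_le_trans xy.
      have yc0 : 0 < y <= c by rewrite y0.
      have := dPhi _ yc0 => D1.
      have D : is_derive y 1 (fun y => Q * Phi y) _ := is_deriveZ Q D1.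
      exact: D.
    - move=> y /andP[xy yc]; have y0 : 0 < y by exact: lt_le_trans xy.
      have yc0 : 0 < y <= c by rewrite y0.
      set S := \sum_j F j y ^+ 2.
      have S0 : 0 <= S by apply: sumr_ge0 => j _; exact: sqr_ge0.
      have FS j : F j y ^+ 2 <= S.
        by rewrite /S (bigD1 j)//= lerDl sumr_ge0// => k _; exact: sqr_ge0.
      have FF : F i y ^+ 2 <= S by exact: FS.
      have G : `|F i y * (\sum_j B i j y * F j y)| <= K * #|T|%:R * S.
        rewrite normrM.
        have Sq j : `|F j y| <= Num.sqrt S.
          by rewrite -sqrtr_sqr ler_wsqrtr.
        have := coupling_le i yc0 Sq => E.
        apply: le_trans (ler_pM _ _ (Sq i) E) _; rewrite ?normr_ge0//.
        by rewrite mulrCA -expr2 sqr_sqrtr.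
      have -> : F i y ^+ 2 + y * (2 * F i y *
          (s i / y * F i y + \sum_j B i j y * F j y)) =
        (1 + 2 * s i) * F i y ^+ 2 + 2 * y * (F i y * (\sum_j B i j y * F j y)).
        by field; rewrite gt_eqF.
      have -> : Q * S = (1 + 2 * al) * S + 2 * c * (K * #|T|%:R * S).
        by rewrite /Q; ring.
      apply: le_trans (ler_normD _ _) _; rewrite lerD//.
        rewrite normrM (ger0_norm (sqr_ge0 _)) ler_pM ?sqr_ge0//.
        by have := al2; case: (sal i) => ->; rewrite ler_norml; lra.
      have y2 : 0 <= 2 * y by rewrite mulr_ge0// ltW.
      rewrite normrM ger0_norm//.
      by rewrite ler_pM// ler_pM2l.
  rewrite /f /g1.
  rewrite distrC ler_norml => /andP[_ E].
  have := mulr_ge0 Q0 (Phi0 x xc); rewrite /M; lra.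
exists (\sum_i Num.sqrt (M i)); first by apply: sumr_ge0 => i _; exact: sqrtr_ge0.
move=> i x xc; have /andP[x0 _] := xc.
apply: (@le_trans _ _ (Num.sqrt (M i) * x `^ (- (1 / 2)))); last first.
  rewrite ler_wpM2r ?powR_ge0// (bigD1 i)//= lerDl.
  by apply: sumr_ge0 => j _; exact: sqrtr_ge0.
rewrite -sqrtr_sqr powRN div1r powR12_sqrt ?(ltW x0)// -sqrtrV -?sqrtrM//.
- by rewrite ler_wsqrtr// ler_pdivlMr// mulrC key.
- by apply: le_trans (key i x xc); rewrite mulr_ge0 ?sqr_ge0 ?ltW.
- by rewrite ltW.
Qed.

Lemma coupling_power i (g C : R) : (forall j x, 0 < x <= c -> `|F j x| <= C * x `^ g) ->
  forall x, 0 < x <= c ->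
  `|x `^ (- s i) * \sum_j B i j x * F j x| <= K * #|T|%:R * C * x `^ (g - s i).
Proof.
move=> H x xc; have /andP[x0 _] := xc.
rewrite normrM ger0_norm ?powR_ge0// (addrC g) powRDpos// mulrCA.
by rewrite ler_wpM2l ?powR_ge0// -(mulrA (K * #|T|%:R)) coupling_le// => j; exact: H.
Qed.

(** Where [s i = - al], the homogeneous solution [x `^ (- al)] is too large to be
    present, hence the component gains a full power over the coupling term. *)
Lemma decaying_component i (g g' : R) : s i = - al -> 0 < al + g -> g' <= g + 1 ->
  power_bounded g ->
  exists2 C, 0 <= C & forall x, 0 < x <= c -> `|F i x| <= C * x `^ g'.
Proof.
move=> si ag gg' [C C0 HC].
suff [D D0 HD] : exists2 D, 0 <= D &
    forall x, 0 < x <= c -> `|F i x| <= D * x `^ (g + 1).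
  exists (D * c `^ (g + 1 - g')); first by rewrite mulr_ge0 ?powR_ge0.
  move=> x xc; apply: le_trans (HD x xc) _; rewrite -mulrA ler_wpM2l//.
  by case/andP: xc => x0 xc; exact: ler_powR_exp.
pose k := K * #|T|%:R * C.
have k0 : 0 <= k by rewrite /k !mulr_ge0// (K0 i).
have ag1 : g + al + 1 != 0 by rewrite gt_eqF//; lra.
exists (k / (g + al + 1)); first by rewrite divr_ge0//; lra.
move=> x xc; have /andP[x0 xc'] := xc.
(* Integrate from [y] to [x]; the boundary term at [y] tends to 0 with [y]. *)
have H1 y : 0 < y <= x -> `|x `^ al * F i x| <=
    k / (g + al + 1) * x `^ (g + al + 1) + C * y `^ (al + g).
  move=> /andP[y0 yx].
  pose f := fun y => y `^ al * F i y; pose g1 := fun y => k / (g + al + 1) * y `^ (g + al + 1).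
  have : `|f x - f y| <= g1 x - g1 y.
    apply: (@le_increment R f g1 (fun y => y `^ al * \sum_j B i j y * F j y)
      (fun y => k * y `^ (g + al)) y x yx).
    - move=> z /andP[yz zx]; have z0 : 0 < z <= c.
        by rewrite (lt_le_trans y0 yz) (le_trans zx).
      by have := is_derive_twisted i z0; rewrite si opprK.
    - move=> z /andP[yz zx]; have z0 : 0 < z by rewrite (lt_le_trans y0 yz).
      have := is_derive_scaled_powR k z0 ag1.
      by rewrite addrK.
    - move=> z /andP[yz zx]; have z0 : 0 < z <= c.
        by rewrite (lt_le_trans y0 yz) (le_trans zx).
      by have := coupling_power i HC z0; rewrite si opprK.
  rewrite /f /g1.
  have yc : 0 < y <= c by rewrite y0 (le_trans yx).
  have E1 : `|y `^ al * F i y| <= C * y `^ (al + g).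
    by rewrite normrM ger0_norm ?powR_ge0// powRDpos// mulrCA ler_wpM2l ?powR_ge0// HC.
  have E2 : 0 <= k / (g + al + 1) * y `^ (g + al + 1).
    by rewrite mulr_ge0 ?powR_ge0// divr_ge0//; lra.
  move=> E3.
  have := ler_normD (x `^ al * F i x - y `^ al * F i y) (y `^ al * F i y).
  by rewrite subrK; lra.
have H2 : `|x `^ al * F i x| <= k / (g + al + 1) * x `^ (g + al + 1).
  rewrite -subr_le0 -(mulr0 C).
  apply: (@cvgr_to_ge _ (0^'+) _ _ (fun y => C * y `^ (al + g))).
    by apply: cvgM; [exact: cvg_cst|exact: powR_cvg0].
  near=> y; rewrite lerBlDl; apply: H1; apply/andP; split; near: y.
    exact: nbhs_right_gt.
  exact: nbhs_right_ltW.
move: H2; rewrite normrM ger0_norm ?powR_ge0//.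
have -> : x `^ (g + al + 1) = x `^ al * x `^ (g + 1) by rewrite -powRDpos//; congr powR; ring.
by rewrite mulrCA ler_pM2l ?powR_gt0.
Unshelve. all: by end_near. Qed.

(** Where [s i = al], the twisted component is integrated from [c] towards 0, and
    the homogeneous solution limits the gain to exponents below [al].  At the
    exponent [al] itself the integral would be logarithmic if [g + 1 = al], which
    is why [g + 1] has to exceed it in [growing_component_sharp]. *)
Lemma growing_component i (g g' : R) : s i = al -> g' <= g + 1 -> g' < al ->
  power_bounded g ->
  exists2 C, 0 <= C & forall x, 0 < x <= c -> `|F i x| <= C * x `^ g'.
Proof.
move=> si gg ga [C C0 HC]; pose k := K * #|T|%:R * C * c `^ (g + 1 - g').
have k0 : 0 <= k by rewrite /k !mulr_ge0// ?powR_ge0// (K0 i).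
have ag1 : g' - al != 0 by rewrite lt_eqF//; lra.
pose p := c `^ (- al) * F i c.
exists (`|p| * c `^ (al - g') + k / (al - g')).
  by rewrite addr_ge0 ?divr_ge0// ?mulr_ge0 ?powR_ge0//; lra.
move=> x xc; have /andP[x0 xc'] := xc.
have H : `|p - x `^ (- al) * F i x| <= k / (al - g') * x `^ (g' - al).
  pose f := fun y => y `^ (- al) * F i y; pose g1 := fun y => k / (g' - al) * y `^ (g' - al).
  have : `|f c - f x| <= g1 c - g1 x.
    apply: (@le_increment R f g1 (fun y => y `^ (- al) * \sum_j B i j y * F j y)
      (fun y => k * y `^ (g' - al - 1)) x c xc').
    - move=> z /andP[yz zx]; have z0 : 0 < z <= c by rewrite (lt_le_trans x0 yz).
      by have := is_derive_twisted i z0; rewrite si.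
    - move=> z /andP[yz zx]; have z0 : 0 < z by rewrite (lt_le_trans x0 yz).
      exact: is_derive_scaled_powR.
    - move=> z /andP[yz zx]; have z0 : 0 < z <= c by rewrite (lt_le_trans x0 yz).
      have := coupling_power i HC z0; rewrite si => E; apply: le_trans E _.
      rewrite /k -[leRHS]mulrA ler_wpM2l ?mulr_ge0// ?(K0 i)//.
      have -> : g + 1 - g' = (g - al) - (g' - al - 1) by ring.
      by case/andP: z0 => z0 zc; apply: ler_powR_exp => //; lra.
  rewrite /f /g1.
  have -> : k / (g' - al) = - (k / (al - g')) by rewrite -mulrN -invrN opprB.
  have : 0 <= k / (al - g') * c `^ (g' - al).
    by rewrite mulr_ge0 ?powR_ge0// divr_ge0//; lra.
  by rewrite -/p !mulNr; lra.
have {H} H : `|x `^ (- al) * F i x| <= `|p| + k / (al - g') * x `^ (g' - al).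
  have := ler_normD (x `^ (- al) * F i x - p) p; rewrite subrK distrC; lra.
have -> : F i x = x `^ al * (x `^ (- al) * F i x) by rewrite mulrA powRNpos// mul1r.
rewrite normrM ger0_norm ?powR_ge0//.
apply: le_trans (ler_wpM2l (powR_ge0 _ _) H) _.
rewrite mulrDr mulrDl lerD//.
  by rewrite mulrC -mulrA ler_wpM2l// ler_powR_exp// ltW.
have -> : x `^ g' = x `^ al * x `^ (g' - al) by rewrite -powRDpos// addrC subrK.
by rewrite [leRHS]mulrCA.
Qed.

Lemma growing_component_sharp i (g : R) : s i = al -> al - 1 < g ->
  power_bounded g ->
  exists2 C, 0 <= C & forall x, 0 < x <= c -> `|F i x| <= C * x `^ al.
Proof.
move=> si ga [C C0 HC]; pose k := K * #|T|%:R * C.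
have k0 : 0 <= k by rewrite /k !mulr_ge0// (K0 i).
have ag0 : 0 < g - al + 1 by lra.
have ag1 : g - al + 1 != 0 by rewrite gt_eqF.
pose p := c `^ (- al) * F i c.
have D0 : 0 <= k / (g - al + 1) by rewrite divr_ge0// ltW.
exists (`|p| + k / (g - al + 1) * c `^ (g - al + 1)).
  by rewrite addr_ge0// mulr_ge0 ?powR_ge0.
move=> x xc; have /andP[x0 xc'] := xc.
have H : `|p - x `^ (- al) * F i x| <= k / (g - al + 1) * c `^ (g - al + 1).
  pose f := fun y => y `^ (- al) * F i y; pose g1 := fun y => k / (g - al + 1) * y `^ (g - al + 1).
  have : `|f c - f x| <= g1 c - g1 x.
    apply: (@le_increment R f g1 (fun y => y `^ (- al) * \sum_j B i j y * F j y)
      (fun y => k * y `^ (g - al)) x c xc').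
    - move=> z /andP[yz zx]; have z0 : 0 < z <= c by rewrite (lt_le_trans x0 yz).
      by have := is_derive_twisted i z0; rewrite si.
    - move=> z /andP[yz zx]; have z0 : 0 < z by rewrite (lt_le_trans x0 yz).
      by have := is_derive_scaled_powR k z0 ag1; rewrite addrK.
    - move=> z /andP[yz zx]; have z0 : 0 < z <= c by rewrite (lt_le_trans x0 yz).
      by have := coupling_power i HC z0; rewrite si.
  rewrite /f /g1.
  rewrite -/p => E; apply: le_trans E _.
  by rewrite gerBl mulr_ge0 ?powR_ge0.
have -> : F i x = x `^ al * (x `^ (- al) * F i x) by rewrite mulrA powRNpos// mul1r.
rewrite normrM ger0_norm ?powR_ge0//.
rewrite mulrC ler_wpM2r ?powR_ge0//.
have := ler_normD (x `^ (- al) * F i x - p) p; rewrite subrK distrC; lra.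
Qed.

Lemma power_bounded_choice (g : R) :
  (forall i, exists2 C, 0 <= C & forall x, 0 < x <= c -> `|F i x| <= C * x `^ g) ->
  power_bounded g.
Proof.
move=> H; have /choice[C HC] : forall i, exists C : R, 0 <= C /\
    forall x, 0 < x <= c -> `|F i x| <= C * x `^ g.
  by move=> i; have [C] := H i; exists C.
have C0 i : 0 <= C i by case: (HC i).
exists (\sum_i C i); first exact: sumr_ge0.
move=> i x xc; apply: le_trans ((HC i).2 x xc) _.
by rewrite ler_wpM2r ?powR_ge0// (bigD1 i)//= lerDl sumr_ge0.
Qed.

(** Each pass through the system improves the exponent by one, until the
    exponent [al] of the square integrable homogeneous solution is met. *)
Lemma square_integrable_power_bounded :
  power_bounded (- (1 / 2)) -> power_bounded al.
Proof.
move=> H0; have al2' := al2.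
(* Staying 1/2 below [al] keeps every step but the last away from the
   logarithmic case. *)
pose m k : R := Num.min (k%:R - 1 / 2) (al - 1 / 2).
have Hk k : power_bounded (m k).
  elim: k => [|k IH].
    by rewrite /m sub0r min_l//; lra.
  have mm : m k.+1 <= m k + 1.
    by rewrite /m -natr1 !minEle; do 2 case: ifPn; rewrite -?ltNge; lra.
  have m1 : - (1 / 2) <= m k by rewrite /m le_min; have := ler0n R k; lra.
  have m2 : m k.+1 < al by rewrite /m gt_min; apply/orP; right; lra.
  apply: power_bounded_choice => i; case: (sal i) => si.
    exact: (growing_component si mm m2 IH).
  by apply: (decaying_component si _ mm IH); lra.
have [k kal] : exists k : nat, al <= k%:R.
  by exists (Num.truncn al).+1; rewrite ltW// truncnS_gt.
have := Hk k; rewrite /m min_r; last by lra.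
move=> H; apply: power_bounded_choice => i; case: (sal i) => si.
  by apply: (growing_component_sharp si _ H); lra.
by apply: (decaying_component si _ _ H); lra.
Qed.

Section Derivative.
Context (lB : forall i j x y, 0 < x <= c -> 0 < y <= c ->
  `|B i j x - B i j y| <= K * `|x - y|).

Let dFv i x := s i / x * F i x + \sum_j B i j x * F j x.

Let norm_s i : `|s i| = al.
Proof. by have al2' := al2; case: (sal i) => ->; rewrite ?normrN ger0_norm//; lra. Qed.

Let nT0 : 0 <= K * #|T|%:R.
Proof.
have [T0 _|T0] := fintype.pickP (@predT T); first by rewrite mulr_ge0// (K0 T0).
by rewrite (eq_card0 T0) mulr0.
Qed.

Lemma derivative_power (g : R) : power_bounded g ->
  exists2 C, 0 <= C & forall i x, 0 < x <= c -> `|dFv i x| <= C * x `^ (g - 1).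
Proof.
move=> [C C0 HC]; have al0 : 0 <= al by have := al2; lra.
exists (al * C + K * #|T|%:R * (C * c `^ (g - (g - 1)))).
  by rewrite addr_ge0 ?(mulr_ge0 al0)// (mulr_ge0 nT0)// mulr_ge0 ?powR_ge0.
move=> i x xc; have /andP[x0 xc'] := xc.
rewrite [leRHS]mulrDl; apply: le_trans (ler_normD _ _) _; rewrite lerD//.
  rewrite (_ : s i / x * F i x = s i * (F i x / x)); last by rewrite mulrAC mulrA.
  rewrite 2!normrM norm_s normfV (gtr0_norm x0) -mulrA ler_wpM2l//.
  by rewrite ler_pdivrMr// -mulrA powR_mulr// subrK HC.
rewrite -(mulrA (K * #|T|%:R)) coupling_le// => j; apply: le_trans (HC j x xc) _.
by rewrite -mulrA ler_wpM2l// ler_powR_exp//; lra.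
Qed.

(** Reduces Lipschitz bounds for the derivatives to those for the quotients by [x]
    and for the components, since the singular term of the right-hand side is
    [s i] times such a quotient. *)
Lemma derivative_increment i x y D D' M : 0 < x -> x <= y -> y <= c ->
  0 <= D' -> 0 <= M ->
  `|F i y / y - F i x / x| <= D * (y - x) ->
  (forall j, `|F j y - F j x| <= D' * (y - x)) ->
  (forall j, `|F j x| <= M) ->
  `|dFv i y - dFv i x| <= (al * D + K * #|T|%:R * (M + D')) * (y - x).
Proof.
move=> x0 xy yc D0 M0 H1 H2 H3; have al0 : 0 <= al by have := al2; lra.
have xc : 0 < x <= c by rewrite x0 (le_trans xy).
have yc' : 0 < y <= c by rewrite (lt_le_trans x0).
have -> : dFv i y - dFv i x = s i * (F i y / y - F i x / x) +
    \sum_j B i j y * (F j y - F j x) + \sum_j (B i j y - B i j x) * F j x.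
  have E : \sum_j B i j y * F j y - \sum_j B i j x * F j x =
      \sum_j B i j y * (F j y - F j x) + \sum_j (B i j y - B i j x) * F j x.
    by rewrite -sumrB -big_split/=; apply: eq_bigr => j _; ring.
  by rewrite -[RHS]addrA -E /dFv; ring.
rewrite mulrDl -addrA; apply: le_trans (ler_normD _ _) _; rewrite lerD//.
  by rewrite normrM norm_s -mulrA ler_wpM2l.
apply: le_trans (ler_normD _ _) _; rewrite addrC.
have -> : K * #|T|%:R * (M + D') * (y - x) =
  K * #|T|%:R * M * (y - x) + K * #|T|%:R * D' * (y - x) by ring.
rewrite lerD//; last first.
  apply: le_trans (ler_norm_sum _ _ _) _.
  apply: (@le_trans _ _ (\sum_(j : T) K * (D' * (y - x)))).
    by apply: ler_sum => j _; rewrite normrM ler_pM// bB.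
  by rewrite sumr_const -mulr_natr le_eqVlt; apply/orP; left; apply/eqP; ring.
apply: le_trans (ler_norm_sum _ _ _) _.
apply: (@le_trans _ _ (\sum_(j : T) K * (y - x) * M)).
  apply: ler_sum => j _; rewrite normrM ler_pM//.
  by apply: le_trans (lB _ _ yc' xc) _; rewrite ger0_norm ?subr_ge0.
by rewrite sumr_const -mulr_natr le_eqVlt; apply/orP; left; apply/eqP; ring.
Qed.

Let is_derive_quotient i x : 0 < x <= c ->
  is_derive x 1 (fun y => F i y / y) (dFv i x / x - F i x / x ^+ 2).
Proof.
move=> /[dup] xc /andP[x0 _]; have D1 := dF i xc.
have D2 := is_deriveV (lt0r_neq0 x0) (is_derive_id x 1).
have D : is_derive x 1 (fun y => F i y / y) _ := is_deriveM D1 D2.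
by apply: (is_derive_eq D); rewrite /GRing.scale/= -/(dFv i x); field; rewrite gt_eqF.
Qed.

Let quotient_increment i x y C : 0 < x -> x <= y -> y <= c ->
  (forall t, x <= t <= y -> `|dFv i t / t - F i t / t ^+ 2| <= C) ->
  `|F i y / y - F i x / x| <= C * (y - x).
Proof.
move=> x0 xy yc H; pose f t := F i t / t; pose g1 t := C * t.
have : `|f y - f x| <= g1 y - g1 x.
  apply: (le_increment (df := fun t => dFv i t / t - F i t / t ^+ 2)
      (dg := fun=> C) xy).
  - by move=> t /andP[xt ty]; apply: is_derive_quotient;
      rewrite (lt_le_trans x0 xt) (le_trans ty).
  - by move=> t _; exact: is_derive_mulc.
  - exact: H.
by rewrite /f /g1 -mulrBr.
Qed.

Let component_increment i x y C : 0 < x -> x <= y -> y <= c ->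
  (forall t, x <= t <= y -> `|dFv i t| <= C) -> `|F i y - F i x| <= C * (y - x).
Proof.
move=> x0 xy yc H; pose g1 t := C * t.
have : `|F i y - F i x| <= g1 y - g1 x.
  apply: (le_increment (df := dFv i) (dg := fun=> C) xy).
  - by move=> t /andP[xt ty]; apply: dF; rewrite (lt_le_trans x0 xt) (le_trans ty).
  - by move=> t _; exact: is_derive_mulc.
  - exact: H.
by rewrite /g1 -mulrBr.
Qed.

Lemma derivative_lipschitz_power (g : R) : g <= 2 -> power_bounded g ->
  exists2 C, 0 <= C & forall i x y, 0 < x -> x <= y -> y <= c ->
    `|dFv i y - dFv i x| <= C * x `^ (g - 2) * (y - x).
Proof.
move=> g2 /[dup] pg [C C0 HC]; have [C' C'0 HC'] := derivative_power pg.
have al0 : 0 <= al by have := al2; lra.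
have c0' := c0.
exists (al * (C' + C) + K * #|T|%:R * (C * c `^ 2 + C' * c)).
  rewrite addr_ge0 ?(mulr_ge0 al0) ?addr_ge0// (mulr_ge0 nT0)//.
  by rewrite addr_ge0 ?mulr_ge0 ?powR_ge0// ltW.
move=> i x y x0 xy yc; have xc : 0 < x <= c by rewrite x0 (le_trans xy).
have P t : x <= t <= y -> [/\ 0 < t, t <= c & t `^ (g - 2) <= x `^ (g - 2)].
  move=> /andP[xt ty]; rewrite (lt_le_trans x0 xt) (le_trans ty yc); split=> //.
  by rewrite ler_powR_neg//; lra.
have -> : (al * (C' + C) + K * #|T|%:R * (C * c `^ 2 + C' * c)) * x `^ (g - 2) =
   al * ((C' + C) * x `^ (g - 2)) +
   K * #|T|%:R * (C * c `^ 2 * x `^ (g - 2) + C' * c * x `^ (g - 2)) by ring.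
apply: derivative_increment => //.
- by rewrite !mulr_ge0 ?powR_ge0// ltW.
- by rewrite !mulr_ge0 ?powR_ge0.
- apply: quotient_increment => // t /P[t0 tc tx].
  have tcc : 0 < t <= c by rewrite t0.
  apply: le_trans (ler_normB _ _) _; rewrite [leRHS]mulrDl lerD//.
    apply: le_trans (ler_wpM2l C'0 tx).
    rewrite normrM normfV (gtr0_norm t0) ler_pdivrMr// -mulrA powR_mulr//.
    by rewrite (_ : g - 2 + 1 = g - 1); [exact: HC'|ring].
  apply: le_trans (ler_wpM2l C0 tx).
  rewrite normrM normfV (@ger0_norm _ (t ^+ 2)) ?sqr_ge0// ler_pdivrMr ?exprn_gt0//.
  by rewrite -mulrA -powR_mulrn ?(ltW t0)// -powRDpos// subrK HC.
- move=> j; apply: component_increment => // t /P[t0 tc tx].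
  have tcc : 0 < t <= c by rewrite t0.
  apply: le_trans (HC' j t tcc) _; rewrite -mulrA ler_wpM2l//.
  apply: le_trans (ler_wpM2l (ltW c0') tx).
  have -> : c = c `^ ((g - 1) - (g - 2)).
    by rewrite (_ : _ - _ = 1) ?powRr1 ?ltW//; ring.
  by apply: ler_powR_exp => //; lra.
- move=> j; apply: le_trans (HC j x xc) _; rewrite -mulrA ler_wpM2l//.
  have -> : c `^ 2 = c `^ (g - (g - 2)) by congr powR; ring.
  by case/andP: xc => _ xc; apply: ler_powR_exp => //; lra.
Qed.

(** For [al = 1] the leading behaviour [x `^ al] is smooth.  The components with
    [s i = 1] have a quotient by [x] whose derivative, the coupling term divided
    by [x], is bounded; those with [s i = -1] are [O(x ^+ 2)], so that the
    derivative of their quotient is bounded as well. *)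
Lemma derivative_lipschitz : al = 1 -> power_bounded 1 ->
  exists2 C, 0 <= C & forall i x y, 0 < x -> x <= y -> y <= c ->
    `|dFv i y - dFv i x| <= C * (y - x).
Proof.
move=> al1 /[dup] pg [C C0 HC]; have [C' C'0 HC'] := derivative_power pg.
have c0' := c0.
have [Q Q0 HQ] : exists2 Q, 0 <= Q & forall i t, 0 < t <= c ->
    `|dFv i t / t - F i t / t ^+ 2| <= Q.
  have key i : exists Q : R, 0 <= Q /\ forall t, 0 < t <= c ->
      `|dFv i t / t - F i t / t ^+ 2| <= Q.
    have BF t : 0 < t <= c -> `|(\sum_j B i j t * F j t) / t| <= K * #|T|%:R * C.
      move=> tc; have /andP[t0 tc'] := tc.
      rewrite normrM normfV (gtr0_norm t0) ler_pdivrMr// -(mulrA (K * #|T|%:R)) coupling_le// => j.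
      by have := HC j t tc; rewrite powRr1// ltW.
    case: (sal i) => si.
      exists (K * #|T|%:R * C); split; first by rewrite mulr_ge0.
      move=> t tc; have /andP[t0 tc'] := tc.
      rewrite (_ : _ - _ = (\sum_j B i j t * F j t) / t); first exact: BF.
      by rewrite /dFv si al1; field; rewrite gt_eqF.
    have [||D D0 HD] := decaying_component (g := 1) (g' := 2) si _ _ pg; [lra|lra|].
    exists (2 * D + K * #|T|%:R * C); split.
      by rewrite addr_ge0// mulr_ge0.
    move=> t tc; have /andP[t0 tc'] := tc.
    rewrite (_ : _ - _ = - (2 * (F i t / t ^+ 2)) + (\sum_j B i j t * F j t) / t); last first.
      by rewrite /dFv si al1; field; rewrite gt_eqF.
    apply: le_trans (ler_normD _ _) _; rewrite lerD ?BF//.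
    rewrite normrN normrM ger0_norm// ler_pM2l// normrM normfV.
    rewrite (@ger0_norm _ (t ^+ 2)) ?sqr_ge0// ler_pdivrMr ?exprn_gt0//.
    by have := HD t tc; rewrite powR_mulrn// ltW.
  have /choice[Q HQ] := key.
  have Q0 i : 0 <= Q i by case: (HQ i).
  exists (\sum_i Q i); first exact: sumr_ge0.
  move=> i t tc; apply: le_trans ((HQ i).2 t tc) _.
  by rewrite (bigD1 i)//= lerDl sumr_ge0.
exists (al * Q + K * #|T|%:R * (C * c + C')).
  have al0 : 0 <= al by have := al2; lra.
  by rewrite addr_ge0 ?(mulr_ge0 al0)// (mulr_ge0 nT0)// addr_ge0// mulr_ge0// ltW.
move=> i x y x0 xy yc; have xc : 0 < x <= c by rewrite x0 (le_trans xy).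
have P t : x <= t <= y -> 0 < t <= c.
  by move=> /andP[xt ty]; rewrite (lt_le_trans x0 xt) (le_trans ty yc).
apply: derivative_increment => //.
- by rewrite mulr_ge0// ltW.
- by apply: quotient_increment => // t /P tc; exact: HQ.
- move=> j; apply: component_increment => // t /P tc.
  by have := HC' j t tc; rewrite subrr powRr0 mulr1.
- move=> j; apply: le_trans (HC j x xc) _; rewrite ler_wpM2l//.
  by rewrite powRr1 ?(ltW x0)//; case/andP: xc.
Qed.

End Derivative.

End SingularSystem.

(** * Piecewise affine interpolation of a function singular at the origin *)
Section Interpolation.
Context {R : realType}.
Implicit Types (f df : R -> R).

(** The slope [B] is a value of [df], hence within the oscillation [D] of every
    other value; the error vanishes at [a], hence is at most [D * (x - a)]. *)
Lemma affine_interpolation_error f df (a b A B D : R) : a < b ->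
  {within `[a, b], continuous f} ->
  (forall x, a < x < b -> is_derive x 1 f (df x)) ->
  (forall x y, a < x < b -> a < y < b -> `|df x - df y| <= D) ->
  A + a * B = f a -> A + b * B = f b ->
  forall x, a < x < b ->
    `|df x - B| <= D /\ `|f x - (A + x * B)| <= D * (x - a).
Proof.
move=> ab cf Hdf HD Ea Eb x /[dup] axb /andP[ax xb].
have [z zab Ez] : exists2 z, a < z < b & B = df z.
  have dfab y : y \in `]a, b[ -> is_derive y 1 f (df y) by rewrite in_itv/=; exact: Hdf.
  have [z] := MVT ab dfab cf; rewrite in_itv/= => zab; rewrite -Ea -Eb => E.
  exists z => //; have ba : b - a != 0 by rewrite subr_eq0 gt_eqF.
  by apply: (mulIf ba); rewrite -E; ring.
split; first by rewrite Ez HD.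
have dfax y : y \in `]a, x[ -> is_derive y 1 f (df y).
  by rewrite in_itv/= => /andP[ay yx]; apply: Hdf; rewrite ay (lt_trans yx).
have cf' : {within `[a, x], continuous f}.
  apply: continuous_subspaceW cf => y /=; rewrite !in_itv/= => /andP[-> yx] /=.
  by rewrite (le_trans yx)// ltW.
have [y] := MVT ax dfax cf'; rewrite in_itv/= => /andP[ay yx] E.
have -> : f x - (A + x * B) = (df y - df z) * (x - a).
  by rewrite mulrBl -E -Ez -Ea; ring.
rewrite normrM [X in _ * X]ger0_norm ?subr_ge0 ?(ltW ax)//.
rewrite ler_wpM2r ?subr_ge0 ?(ltW ax)// HD//.
by rewrite ay (lt_trans yx).
Qed.

(** The error bound aimed at, for the uniform mesh of width [h] on [(0, c]];
    at the singular endpoint the interpolant takes the value 0. *)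
Definition mesh_error_le f df (c r sg C : R) :=
  forall (h : R) (j : nat), 0 < h -> j.+1%:R * h <= c ->
  forall A B, A + j.+1%:R * h * B = f (j.+1%:R * h) ->
    A + j%:R * h * B = (if j is 0%N then 0 else f (j%:R * h)) ->
  forall x, j%:R * h < x < j.+1%:R * h ->
    `|df x - B| <= C * h `^ r * x `^ (- sg) /\
    `|f x - (A + x * B)| <= C * h `^ r * x `^ (- sg) * x.

Lemma mesh_error_leW f df (c r sg C C' : R) : C <= C' ->
  mesh_error_le f df c r sg C -> mesh_error_le f df c r sg C'.
Proof.
move=> CC H h j h0 hc A B EB EA x xab; have [E1 E2] := H h j h0 hc A B EB EA x xab.
have hx : C * h `^ r * x `^ (- sg) <= C' * h `^ r * x `^ (- sg).
  by rewrite -!mulrA ler_wpM2r// mulr_ge0// powR_ge0.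
split; first exact: le_trans hx.
apply: le_trans E2 _; rewrite ler_wpM2r//; case/andP: xab => xa _.
by apply: ltW; apply: le_lt_trans xa; rewrite mulr_ge0// ltW.
Qed.

(** One weight serves all cells: on a cell [[a, a + h]] with [h <= a] the error is
    [h * O(a `^ (g - 2))] and [h <= x <= 2 * a], while on the first cell it is
    [O(x `^ (g - 1) + h `^ (g - 1))] and [x <= h]; both are at most a multiple of
    [h `^ r * x `^ (- sg)]. *)
Lemma mesh_error_power f df (c g r sg C : R) :
  0 <= C -> 0 <= r <= 1 -> 0 <= sg -> sg = r + 1 - g ->
  (forall x, 0 < x <= c -> is_derive x 1 f (df x)) ->
  (forall x, 0 < x <= c -> `|f x| <= C * x `^ g) ->
  (forall x, 0 < x <= c -> `|df x| <= C * x `^ (g - 1)) ->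
  (forall x y, 0 < x -> x <= y -> y <= c ->
     `|df y - df x| <= C * x `^ (g - 2) * (y - x)) ->
  mesh_error_le f df c r sg ((2 + 2 `^ (2 - g)) * C).
Proof.
move=> C0 /andP[r0 r1] sg0 sgE Hd Hf Hdf HL h [|j] h0 hc A B EB EA x.
  rewrite mul1r mul0r => /andP[x0 xh]; rewrite mul1r in hc EB.
  rewrite mul0r mul0r addr0 in EA; subst A; rewrite add0r in EB.
  have xh' := ltW xh.
  have Bx : B = f h / h by rewrite -EB mulrAC divff ?mul1r// gt_eqF.
  have P1 : x `^ (g - 1) <= h `^ r * x `^ (- sg).
    have -> : x `^ (g - 1) = x `^ r * x `^ (- sg).
      by rewrite -powRDpos//; congr powR; rewrite sgE; ring.
    by rewrite ler_wpM2r ?powR_ge0// ge0_ler_powR// nnegrE ltW.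
  have P2 : h `^ (g - 1) <= h `^ r * x `^ (- sg).
    have -> : h `^ (g - 1) = h `^ r * h `^ (- sg).
      by rewrite -powRDpos//; congr powR; rewrite sgE; ring.
    by rewrite ler_wpM2l ?powR_ge0// ler_powR_neg// oppr_le0.
  have BB : `|B| <= C * h `^ (g - 1).
    rewrite Bx normrM normfV (gtr0_norm h0) ler_pdivrMr// -mulrA powR_mulr//.
    by rewrite subrK Hf// h0.
  have xc : 0 < x <= c by rewrite x0 (le_trans xh').
  have G : C * x `^ (g - 1) + C * h `^ (g - 1) <=
      (2 + 2 `^ (2 - g)) * C * h `^ r * x `^ (- sg).
    have := ler_wpM2l C0 P1; have := ler_wpM2l C0 P2.
    have : 0 <= 2 `^ (2 - g) * (C * (h `^ r * x `^ (- sg))).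
      by rewrite !mulr_ge0 ?powR_ge0.
    lra.
  split.
    by apply: le_trans (ler_normB _ _) _; apply: le_trans G; rewrite lerD// Hdf.
  apply: le_trans (ler_normB _ _) _.
  apply: le_trans (ler_wpM2r (ltW x0) G); rewrite mulrDl lerD//.
    by rewrite -mulrA powR_mulr// subrK Hf.
  by rewrite add0r normrM (gtr0_norm x0) mulrC ler_wpM2r// ltW.
move=> /[dup] xab /andP[]; set a := j.+1%:R * h in EA xab *.
have bE : j.+2%:R * h = a + h by rewrite /a -natr1 mulrDl mul1r.
rewrite bE in hc EB xab * => ax xb.
have ha : h <= a by rewrite /a ler_peMl ?(ltW h0)// ler1n.
have a0 : 0 < a by exact: lt_le_trans ha.
have x0 : 0 < x by exact: lt_trans ax.
have cc y : a <= y <= a + h -> 0 < y <= c.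
  by move=> /andP[ay yb]; rewrite (lt_le_trans a0 ay) (le_trans yb).
have g2 : g <= 2 by lra.
have HD y z : a < y < a + h -> a < z < a + h ->
    `|df y - df z| <= C * a `^ (g - 2) * h.
  wlog yz : y z / z <= y.
    move=> W Hy Hz; case: (leP z y) => [|/ltW] yz; first exact: W.
    by rewrite distrC; exact: W.
  move=> /andP[ay yb] /andP[az zb].
  apply: le_trans (HL z y (lt_trans a0 az) yz (le_trans (ltW yb) hc)) _.
  rewrite ler_pM ?mulr_ge0 ?powR_ge0 ?subr_ge0//; last by lra.
  by rewrite ler_wpM2l// ler_powR_neg ?(ltW az)//; lra.
have [||||||E1 E2] := @affine_interpolation_error f df a (a + h) A B
    (C * a `^ (g - 2) * h) _ _ _ HD _ _ x.
- by rewrite ltrDl.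
- apply: derivable_within_continuous => y; rewrite in_itv/= => yab.
  by have [] := Hd y (cc y yab).
- by move=> y /andP[ay yb]; apply: Hd; apply: cc; rewrite !ltW.
- exact: EA.
- exact: EB.
- by rewrite ax.
have G : C * a `^ (g - 2) * h <= (2 + 2 `^ (2 - g)) * C * h `^ r * x `^ (- sg).
  have P1 : a `^ (g - 2) <= 2 `^ (2 - g) * x `^ (g - 2).
    have -> : 2 `^ (2 - g) * x `^ (g - 2) = (x / 2) `^ (g - 2).
      rewrite powRM ?(ltW x0)//.
      rewrite mulrC -powR_inv1// -powRrM; congr (_ * powR _ _); ring.
    by rewrite ler_powR_neg//; lra.
  have P2 : x `^ (g - 2) * h <= h `^ r * x `^ (- sg).
    have -> : x `^ (g - 2) * h = h `^ r * (h `^ (1 - r) * x `^ (g - 2)).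
      rewrite mulrA -powRDpos// (_ : r + (1 - r) = 1); last by ring.
      by rewrite powRr1 ?(ltW h0)// mulrC.
    have -> : x `^ (- sg) = x `^ (1 - r) * x `^ (g - 2).
      by rewrite -powRDpos//; congr powR; rewrite sgE; ring.
    rewrite ler_wpM2l ?powR_ge0// ler_wpM2r ?powR_ge0//.
    by rewrite ge0_ler_powR ?subr_ge0// ?nnegrE ?(ltW h0) ?(ltW x0)//; lra.
  have H1 : C * a `^ (g - 2) * h <= C * (2 `^ (2 - g) * x `^ (g - 2)) * h.
    by rewrite ler_wpM2r ?(ltW h0)// ler_wpM2l.
  have H2 : C * 2 `^ (2 - g) * (x `^ (g - 2) * h) <=
      C * 2 `^ (2 - g) * (h `^ r * x `^ (- sg)).
    by rewrite ler_wpM2l// mulr_ge0// powR_ge0.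
  have H3 : 0 <= C * (h `^ r * x `^ (- sg)) by rewrite !mulr_ge0 ?powR_ge0.
  lra.
split; first exact: le_trans G.
apply: le_trans E2 _; rewrite ler_pM ?subr_ge0 ?(ltW ax)//.
  by rewrite !mulr_ge0 ?powR_ge0// ltW.
by rewrite gerBl ltW.
Qed.

(** Here [f], extended by its limit 0, is differentiable with Lipschitz derivative
    up to the endpoint, and the first cell is like any other. *)
Lemma mesh_error_lipschitz f df (c C : R) : 0 <= C ->
  (forall x, 0 < x <= c -> is_derive x 1 f (df x)) ->
  (forall x, 0 < x <= c -> `|f x| <= C * x) ->
  (forall x y, 0 < x -> x <= y -> y <= c -> `|df y - df x| <= C * (y - x)) ->
  mesh_error_le f df c 1 0 C.
Proof.
move=> C0 Hd Hf HL h j h0 hc A B EB EA x xab.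
pose f0 (y : R) := if y <= 0 then 0 else f y.
have f0E y : 0 < y -> f0 y = f y by move=> y0; rewrite /f0 leNgt y0.
have c0 : 0 < c by apply: lt_le_trans hc; rewrite mulr_gt0.
set a := j%:R * h in EA xab *.
have bE : j.+1%:R * h = a + h by rewrite /a -natr1 mulrDl mul1r.
rewrite bE in hc EB xab *; have /andP[ax xb] := xab.
have a0 : 0 <= a by rewrite /a mulr_ge0// ltW.
have x0 : 0 < x by exact: le_lt_trans ax.
have D0 y : 0 < y <= c -> is_derive y 1 f0 (df y).
  move=> yc; apply: near_eq_is_derive (Hd y yc) => //.
  case/andP: yc => y0 _; near=> z; rewrite f0E//; near: z; exact: lt_nbhsr.
have f0_cvg : f0 y @[y --> 0^'+] --> f0 0.
  rewrite {2}/f0 lexx; apply/cvgr0Pnorm_le => e e0.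
  near=> y; have y0 : 0 < y by near: y; exact: nbhs_right_gt.
  rewrite f0E//; apply: le_trans (Hf y _) _.
    rewrite y0; near: y; exact: nbhs_right_le.
  have ye : y <= e / (C + 1).
    by near: y; apply: nbhs_right_le; rewrite divr_gt0// ltr_wpDl.
  move: ye; rewrite ler_pdivlMr ?ltr_wpDl// mulrC; nra.
have f0_cont : {within `[a, a + h], continuous f0}.
  apply: (@continuous_subspaceW _ _ _ `[0, c]).
    move=> y /=; rewrite !in_itv/= => /andP[ay yb].
    by rewrite (le_trans a0)// (le_trans yb).
  apply/continuous_within_itvP => //; split => //.
    move=> y; rewrite in_itv/= => /andP[y0 yc].
    apply: differentiable_continuous; apply/derivable1_diffP.
    by have [] := D0 y; rewrite ?y0 ?ltW.
  apply: cvg_at_left_filter.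
  have : {for c, continuous f0}.
    apply: differentiable_continuous; apply/derivable1_diffP.
    by have [] := D0 c; rewrite ?c0 ?lexx.
  exact.
have [||||||E1 E2] := @affine_interpolation_error f0 df a (a + h) A B
    (C * h) _ f0_cont _ _ _ _ x.
- by rewrite ltrDl.
- move=> y /andP[ay yb]; apply: D0.
  by rewrite (le_lt_trans a0)// ltW// (lt_le_trans yb).
- move=> y z; wlog yz : y z / z <= y.
    move=> W Hy Hz; case: (leP z y) => [|/ltW] yz; first exact: W.
    by rewrite distrC; exact: W.
  move=> /andP[ay yb] /andP[az zb].
  apply: le_trans (HL z y (le_lt_trans a0 az) yz (le_trans (ltW yb) hc)) _.
  by rewrite ler_wpM2l//; lra.
- rewrite EA /a; case: (j) => [|k]; first by rewrite mul0r /f0 lexx.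
  by rewrite f0E// mulr_gt0.
- by rewrite f0E// (lt_trans x0).
- exact: xab.
rewrite powRr1 ?(ltW h0)// oppr0 powRr0 mulr1; split => //.
rewrite -(f0E x x0); apply: le_trans E2 _; rewrite ler_wpM2l ?mulr_ge0 ?(ltW h0)//.
by rewrite gerBl.
Unshelve. all: by end_near. Qed.

End Interpolation.

(** * Lipschitz bounds for the potential *)
Section Potential.
Context {R : realType}.

Lemma norm_sub_expr (q s t : R) (k : nat) : `|s| <= q -> `|t| <= q ->
  `|s ^+ k.+1 - t ^+ k.+1| <= k.+1%:R * q ^+ k * `|s - t|.
Proof.
move=> sq tq; have q0 : 0 <= q by exact: le_trans sq.
rewrite subrXX normrM mulrC ler_wpM2r//.
apply: le_trans (ler_norm_sum _ _ _) _.
apply: (@le_trans _ _ (\sum_(i < k.+1) q ^+ k)); last first.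
  by rewrite sumr_const card_ord mulr_natl.
apply: ler_sum => i _; rewrite normrM !normrX.
have -> : q ^+ k = q ^+ (k.+1.-1 - i) * q ^+ i by rewrite -exprD subnK// -ltnS.
by rewrite ler_pM ?exprn_ge0// lerXn2r ?nnegrE.
Qed.

(** Restricted to a real neighbourhood, the parts of an analytic function are real
    power series.  Convergence at distance [e / 2] bounds the coefficients
    geometrically, and within an eighth of [e] the increments of the monomials
    are dominated by a geometric series times [`|x - y|]. *)
Lemma power_series_lipschitz (a : nat -> R) (f : R -> R) (x0 e : R) : 0 < e ->
  (forall x, `|x - x0| < e ->
     series (fun k => a k * (x - x0) ^+ k) @ \oo --> f x) ->
  exists L d : R, 0 < d /\ forall x y, `|x - x0| < d -> `|y - x0| < d ->
    `|f x - f y| <= L * `|x - y|.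
Proof.
move=> e0 H; pose rho := e / 2; have rho0 : 0 < rho by rewrite divr_gt0.
have [M M0 HM] : exists2 M, 0 <= M & forall k, `|a k| * rho ^+ k <= M.
  have : cvgn (series (fun k => a k * (x0 + rho - x0) ^+ k)).
    apply/cvg_ex; exists (f (x0 + rho)); apply: H.
    by rewrite addrC addKr gtr0_norm// /rho; lra.
  move=> /cvg_series_cvg_0 c0.
  have /cvg_seq_bounded[M [Mr HM]] : cvgn (fun k => a k * (x0 + rho - x0) ^+ k).
    by apply/cvg_ex; exists 0.
  exists (`|M| + 1) => // k.
  have M1 : M < `|M| + 1 by rewrite (le_lt_trans (ler_norm M)) ?ltrDl.
  have := HM _ M1 k I; rewrite /= (_ : x0 + rho - x0 = rho); last by ring.
  by rewrite normrM normrX (gtr0_norm rho0).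
pose q := rho / 4; have q0 : 0 < q by rewrite divr_gt0.
exists (8 * M / rho), q; split => // x y xq yq.
have qe : q < e by rewrite /q /rho; lra.
have term k : `|a k * (x - x0) ^+ k - a k * (y - x0) ^+ k| <=
    4 * M / rho * 2^-1 ^+ k * `|x - y|.
  rewrite -mulrBr normrM.
  case: k => [|k]; first by rewrite !expr0 subrr normr0 mulr0 !mulr_ge0// invr_ge0 ltW.
  have E := norm_sub_expr k (ltW xq) (ltW yq).
  rewrite (_ : x - x0 - (y - x0) = x - y) in E; last by ring.
  apply: le_trans (ler_wpM2l (normr_ge0 _) E) _; rewrite mulrA ler_wpM2r//.
  have k2 : k.+1%:R <= 2 ^+ k.+1 :> R.
    by rewrite -natrX ler_nat ltnW// ltn_expl.
  apply: (@le_trans _ _ (`|a k.+1| * (2 ^+ k.+1 * q ^+ k))).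
    by rewrite ler_wpM2l// ler_wpM2r// exprn_ge0// ltW.
  have -> : `|a k.+1| * (2 ^+ k.+1 * q ^+ k) =
      4 / rho * 2^-1 ^+ k.+1 * (`|a k.+1| * rho ^+ k.+1).
    rewrite /q exprMn !exprVn (_ : 4 = 2 ^+ 2); last by ring.
    rewrite -exprM mulnC exprM !exprS.
    have : 2 ^+ k != 0 :> R by rewrite expf_neq0.
    by move=> k0; field; rewrite k0 gt_eqF.
  have -> : 4 * M / rho * 2^-1 ^+ k.+1 = 4 / rho * 2^-1 ^+ k.+1 * M by ring.
  by rewrite ler_wpM2l// !mulr_ge0 ?exprn_ge0 ?invr_ge0// ltW.
have geo n : \sum_(0 <= k < n) (2^-1 : R) ^+ k <= 2.
  suff -> : \sum_(0 <= k < n) (2^-1 : R) ^+ k = 2 - 2 * 2^-1 ^+ n.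
    by rewrite gerBl mulr_ge0// exprn_ge0.
  elim: n => [|n IH]; first by rewrite big_geq// expr0; ring.
  by rewrite big_nat_recr//= IH exprS; field.
have cx : series (fun k => a k * (x - x0) ^+ k) @ \oo --> f x by apply: H; lra.
have cy : series (fun k => a k * (y - x0) ^+ k) @ \oo --> f y by apply: H; lra.
have cxy : `|series (fun k => a k * (x - x0) ^+ k) n -
             series (fun k => a k * (y - x0) ^+ k) n| @[n --> \oo] --> `|f x - f y|.
  exact: cvg_norm (cvgB cx cy).
apply: (@cvgr_to_le _ _ _ _ _ _ _ cxy); near=> n.
rewrite /series /= -sumrB; apply: le_trans (ler_norm_sum _ _ _) _.
apply: le_trans (ler_sum _ (fun k _ => term k)) _.
rewrite -mulr_suml -mulr_sumr ler_wpM2r//.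
have -> : 8 * M / rho = 4 * M / rho * 2 by ring.
by rewrite ler_wpM2l// !mulr_ge0// invr_ge0 ltW.
Unshelve. all: by end_near. Qed.

Definition part (b : bool) (z : R[i]) : R := if b then complex.Im z else complex.Re z.

Lemma partD b z w : part b (z + w) = part b z + part b w.
Proof. by case: b z w => -[? ?] [? ?]. Qed.

Lemma partB b z w : part b (z - w) = part b z - part b w.
Proof. by case: b z w => -[? ?] [? ?]. Qed.

Lemma part_le b z : `|part b z| <= complex.Re `|z|.
Proof.
case: z => x y; rewrite normc_def/=.
by case: b; rewrite /part/= -sqrtr_sqr ler_wsqrtr// ?lerDl ?lerDr sqr_ge0.
Qed.

Lemma part_real b z (r : R) : part b (z * r%:C) = part b z * r.
Proof. by case: z => x y; case: b; rewrite /part/=; ring. Qed.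

Lemma analytic_real_lipschitz (v : R[i] -> R[i]) (x0 : R) b : analytic_at v x0%:C ->
  exists L d : R, 0 < d /\ forall x y, `|x - x0| < d -> `|y - x0| < d ->
    `|part b (v x%:C) - part b (v y%:C)| <= L * `|x - y|.
Proof.
move=> [a /nbhs_ballP[/= e e0 He]].
have /andP[/eqP eIm eRe] : (complex.Im e == 0) && (0 < complex.Re e).
  by move: e0; rewrite ltcE/= eq_sym.
apply: (@power_series_lipschitz (fun k => part b (a k)) _ x0 (complex.Re e) eRe).
move=> x xe; have : ball (x0%:C : R[i]^o) e x%:C.
  rewrite -ball_normE /ball_ /= -rmorphB/= normc_def/= expr0n/= addr0 sqrtr_sqr distrC.
  by rewrite ltcE/= eIm eqxx.
move=> /He /cvgrPdist_le H; apply/cvgrPdist_le => eps eps0.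
have eps0' : 0 < eps%:C :> R[i] by rewrite ltcR.
have := H _ eps0'; apply: filterS => n; rewrite /series/= => Hn.
have <- : part b (\sum_(0 <= k < n) a k * (x%:C - x0%:C) ^+ k) =
   \sum_(0 <= k < n) part b (a k) * (x - x0) ^+ k.
  elim: n {Hn} => [|n IH]; first by rewrite !big_geq//; case: b.
  by rewrite !big_nat_recr//= partD IH -rmorphB -rmorphXn/= part_real.
rewrite -partB; apply: le_trans (part_le _ _) _.
by move: Hn; rewrite lecE/= => /andP[].
Qed.

(** Compactness is applied to the square of pairs of points rather than to the
    segment, because a chain of local Lipschitz bounds is awkward to glue: near
    the diagonal the local bound serves, and near any other pair the quotient is
    bounded as the distance stays away from 0. *)
Lemma lipschitz_on_segment (f : R -> R) (a b : R) : a <= b ->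
  (forall x0, a <= x0 <= b -> exists L d : R, 0 < d /\
     forall x y, `|x - x0| < d -> `|y - x0| < d -> `|f x - f y| <= L * `|x - y|) ->
  exists2 K, 0 <= K & (forall x, a <= x <= b -> `|f x| <= K) /\
    forall x y, a <= x <= b -> a <= y <= b -> `|f x - f y| <= K * `|x - y|.
Proof.
move=> ab H.
pose P (L : R) (p : R * R) := `|f p.1 - f p.2| <= L * `|p.1 - p.2|.
have cK := compact_setX (@segment_compact R a b) (@segment_compact R a b).
move/compact_near_coveringP : cK => /(_ R (pinfty_nbhs R) P _).
have square x0 y0 (r Q : R) : 0 < r ->
    (forall x y L, `|x - x0| < r -> `|y - y0| < r -> Q <= L -> P L (x, y)) ->
    \forall p \near (x0, y0) & L \near +oo, P L p.
  move=> r0 HP; exists (ball x0 r `*` ball y0 r, [set L | Q <= L]).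
    split; last exact: nbhs_pinfty_ge (num_real Q).
    by exists (ball x0 r, ball y0 r) => //; split; exact: nbhsx_ballx.
  move=> [[x y] L] [[/= xr yr] QL]; apply: HP => //.
    by rewrite distrC.
  by rewrite distrC.
have cover p : (`[a, b] `*` `[a, b]) p -> \forall q \near p & L \near +oo, P L q.
  case: p => x0 y0 [/=]; rewrite !in_itv/= => xab yab.
  have [L1 [d1 [d10 H1]]] := H _ xab; have [L2 [d2 [d20 H2]]] := H _ yab.
  have [<-|xy] := eqVneq x0 y0.
    apply: (square _ _ d1 L1) => // x y L xd yd LL; rewrite /P/=.
    by apply: le_trans (H1 x y xd yd) _; rewrite ler_wpM2r.
  pose D := `|x0 - y0|; have D0 : 0 < D by rewrite normr_gt0 subr_eq0.
  pose Q := D + `|L1| * d1 + `|L2| * d2 + `|f x0 - f y0|.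
  apply: (square _ _ (Num.min (D / 4) (Num.min d1 d2)) (2 * Q / D)).
    by rewrite !lt_min d10 d20 divr_gt0.
  move=> x y L; rewrite !lt_min => /and3P[xD xd1 _] /and3P[yD _ yd2] QL.
  rewrite /P/=.
  have fx : `|f x - f x0| <= `|L1| * d1.
    apply: le_trans (H1 x x0 xd1 _) _; first by rewrite subrr normr0.
    apply: le_trans (ler_wpM2r (normr_ge0 _) (ler_norm L1)) _.
    by rewrite ler_wpM2l// ltW.
  have fy : `|f y - f y0| <= `|L2| * d2.
    apply: le_trans (H2 y y0 yd2 _) _; first by rewrite subrr normr0.
    apply: le_trans (ler_wpM2r (normr_ge0 _) (ler_norm L2)) _.
    by rewrite ler_wpM2l// ltW.
  have fxy : `|f x - f y| <= Q.
    have -> : f x - f y = (f x - f x0) + (f x0 - f y0) - (f y - f y0) by ring.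
    apply: le_trans (ler_normB _ _) _; have := ler_normD (f x - f x0) (f x0 - f y0).
    by rewrite /Q; lra.
  have Dxy : D / 2 <= `|x - y|.
    have := ler_normD (x - y) ((y - y0) - (x - x0)).
    rewrite (_ : _ + _ = x0 - y0); last by ring.
    by have := ler_normB (y - y0) (x - x0); rewrite -/D; lra.
  apply: le_trans fxy _; have Q0 : 0 <= Q.
    by rewrite /Q !addr_ge0 ?mulr_ge0// ltW.
  have QD : 0 <= 2 * Q / D by rewrite divr_ge0 ?mulr_ge0// ltW.
  apply: (@le_trans _ _ (2 * Q / D * (D / 2))).
    by rewrite le_eqVlt; apply/orP; left; apply/eqP; field; rewrite gt_eqF.
  by rewrite ler_pM// divr_ge0// ltW.
move=> /(_ cover); move=> [M [Mr HM]].
pose K := `|M| + 1; have K0 : 0 <= K by rewrite addr_ge0.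
have lip x y : a <= x <= b -> a <= y <= b -> `|f x - f y| <= K * `|x - y|.
  move=> xab yab; have := HM K; rewrite /K (le_lt_trans (ler_norm M)) ?ltrDl//.
  by move=> /(_ isT (x, y)); apply; split; rewrite /= in_itv.
exists (`|f a| + K * (b - a) + K); first by rewrite !addr_ge0 ?mulr_ge0 ?subr_ge0.
have Kab : 0 <= K * (b - a) by rewrite mulr_ge0 ?subr_ge0.
split=> [x /[dup] xab /andP[ax xb]|x y xab yab].
  have := lip x a xab; rewrite lexx ab => /(_ isT).
  rewrite (ger0_norm (_ : 0 <= x - a)) ?subr_ge0// => E.
  have := ler_normD (f x - f a) (f a); rewrite subrK.
  have : K * (x - a) <= K * (b - a) by rewrite ler_wpM2l// lerD2r.
  by have := normr_ge0 M; rewrite /K in E K0 *; lra.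
apply: le_trans (lip x y xab yab) _; rewrite ler_wpM2r// lerDr.
by rewrite addr_ge0.
Qed.

Lemma potential_lipschitz (V : R[i] -> 'M[R[i]]_2) :
  analytic_hermitian_potential V -> exists2 K, 0 <= K & forall i j b,
    (forall x : R, 0 <= x <= pi -> `|part b (V x%:C i j)| <= K) /\
    (forall x y : R, 0 <= x <= pi -> 0 <= y <= pi ->
       `|part b (V x%:C i j) - part b (V y%:C i j)| <= K * `|x - y|).
Proof.
move=> [[U [_ segU anV]] _].
have key (t : 'I_2 * 'I_2 * bool) : exists K : R, 0 <= K /\
    ((forall x : R, 0 <= x <= pi -> `|part t.2 (V x%:C t.1.1 t.1.2)| <= K) /\
     (forall x y : R, 0 <= x <= pi -> 0 <= y <= pi ->
     `|part t.2 (V x%:C t.1.1 t.1.2) - part t.2 (V y%:C t.1.1 t.1.2)| <= K * `|x - y|)).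
  have [||K K0 H] := @lipschitz_on_segment (fun x => part t.2 (V x%:C t.1.1 t.1.2)) 0 pi.
  - exact: pi_ge0.
  - move=> x0 x0pi.
    exact: (analytic_real_lipschitz t.2 (anV t.1.1 t.1.2 _ (segU _ x0pi))).
  - by exists K.
have /choice[K HK] := key.
have K0 t : 0 <= K t by case: (HK t).
have KS t : K t <= \sum_t K t by rewrite (bigD1 t)//= lerDl sumr_ge0.
exists (\sum_t K t); first exact: sumr_ge0.
move=> i j b; have [_ [H1 H2]] := HK (i, j, b); split=> [x x0pi|x y x0pi y0pi].
  exact: le_trans (H1 x x0pi) (KS _).
by apply: le_trans (H2 x y x0pi y0pi) _; rewrite ler_wpM2r.
Qed.

End Potential.

(** * From almost everywhere derivatives to continuously differentiable ones *)
Section AbsoluteContinuity.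
Context {R : realType}.
Local Notation mu := (@lebesgue_measure R).
Implicit Types (f g k : R -> R).

Lemma continuous_interior f (a b x : R) : {within `[a, b], continuous f} ->
  a < x < b -> {for x, continuous f}.
Proof.
move=> cf /andP[ax xb]; have ab : a < b by exact: lt_trans xb.
have [+ _ _] := (continuous_within_itvP f ab).1 cf.
by apply; rewrite in_itv/= ax.
Qed.

Lemma loc_abs_cont_continuous f (x : R) : loc_abs_cont f -> 0 < x < pi ->
  {for x, continuous f}.
Proof.
move=> [g Hg] /andP[x0 xpi]; pose a := x / 2; pose b := (x + pi) / 2.
have [a0 ax xb bpi] : [/\ 0 < a, a < x, x < b & b < pi] by rewrite /a /b; split; lra.
have [ig _] := Hg a b a0 (ltW (lt_trans ax xb)) bpi.
have cI := parameterized_integral_continuous (ltW (lt_trans ax xb)) ig.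
have cIx : {for x, continuous (fun y => f a + parameterized_integral mu a y g)}.
  by apply: cvgD; [exact: cvg_cst|apply: (continuous_interior cI); rewrite ax].
have fE y : a <= y <= b -> f a + parameterized_integral mu a y g = f y.
  move=> /andP[ay yb]; have [_ E] := Hg a y a0 ay (le_lt_trans yb bpi).
  by rewrite /parameterized_integral -E addrC subrK.
move: cIx; rewrite /prop_for /continuous_at fE ?(ltW ax) ?(ltW xb)// => cIx.
apply: cvg_trans cIx; apply: near_eq_cvg; near=> y; apply: fE.
by apply/andP; split; apply: ltW; near: y; [exact: lt_nbhsr|exact: lt_nbhsl].
Unshelve. all: by end_near. Qed.

(** Lebesgue's differentiation theorem, localised to a compact subinterval. *)
Lemma loc_abs_cont_ae_derive f g (a b : R) : a < b ->
  mu.-integrable `[a, b] (EFin \o g) ->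
  (forall x, a <= x <= b -> f x - f a = \int[mu]_(t in `[a, x]) g t) ->
  {ae mu, forall x, a < x < b -> derive1 f x = g x}.
Proof.
move=> ab ig Hf; pose G := g \_ `[a, b].
have iG : mu.-integrable setT (EFin \o G).
  rewrite /G -restrict_EFin.
  exact: (@integrable_mkcond _ _ _ mu _ (EFin \o g) (measurable_itv _)).1.
have := @FTC1 R G (BLeft a) _ (integrable_locally (measurable_itv _) ig).
have iGy y : mu.-integrable [set` Interval (BLeft a) (BRight y)] (EFin \o G).
  by apply: integrableS iG => //; exact: measurable_itv.
move=> /(_ iGy); apply: filterS; first exact: (ae_filter_ringOfSetsType mu).
move=> x Hx /andP[ax xb].
have [DG EG] : derivable (fun y => \int[mu]_(t in `[a, y]) G t) x 1 /\
    (fun y => \int[mu]_(t in `[a, y]) G t)^`()%classic x = G x.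
  by apply: Hx; rewrite /= lte_fin.
have GE : G x = g x by rewrite /G patchE mem_set//= in_itv/= !ltW.
have DI := DeriveDef DG (etrans (esym (derive1E _ _)) EG).
have D := is_deriveD (is_derive_cst (f a) x 1) DI.
have near_eq : \forall y \near x, f a + \int[mu]_(t in `[a, y]) G t = f y.
  have : \forall y \near x, a < y < b.
    near=> y; apply/andP; split; near: y; [exact: lt_nbhsr|exact: lt_nbhsl].
  apply: filterS => y /andP[ay yb].
  have -> : \int[mu]_(t in `[a, y]) G t = \int[mu]_(t in `[a, y]) g t.
    apply: eq_Rintegral => t; rewrite inE/= in_itv/= => /andP[at_ ty].
    by rewrite /G patchE mem_set//= in_itv/= at_ (le_trans ty)// ltW.
  by rewrite -Hf ?(ltW ay) ?(ltW yb)//; ring.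
by have [_] := near_eq_is_derive near_eq D; rewrite add0r GE derive1E.
Unshelve. all: by end_near. Qed.

(** An indefinite integral whose derivative agrees almost everywhere with a
    continuous [k] is an indefinite integral of [k]. *)
Lemma loc_abs_cont_is_derive f k :
  loc_abs_cont f -> (forall x, 0 < x < pi -> {for x, continuous k}) ->
  derive1 f = k %[ae mu in `]0, pi[%classic] ->
  forall x, 0 < x < pi -> is_derive x 1 f (k x).
Proof.
move=> [g Hg] ck Hk x /[dup] x0pi /andP[x0 xpi].
(* The larger interval [[a', b']] has [a] and [b] in its interior, where the
   almost everywhere derivative is available. *)
pose a := x / 2; pose b := (x + pi) / 2; pose a' := a / 2; pose b' := (b + pi) / 2.
have [a0 ax xb bpi] : [/\ 0 < a, a < x, x < b & b < pi] by rewrite /a /b; split; lra.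
have [a'0 aa bb b'pi] : [/\ 0 < a', a' < a, b < b' & b' < pi].
  by rewrite /a' /b'; split; lra.
have ab : a < b by exact: lt_trans xb.
have a'b' : a' < b' by rewrite (lt_trans aa)// (lt_trans ab).
have [ig _] := Hg a b a0 (ltW ab) bpi.
have [ig' _] := Hg a' b' a'0 (ltW a'b') b'pi.
have Hf' y : a' <= y <= b' -> f y - f a' = \int[mu]_(t in `[a', y]) g t.
  by move=> /andP[ay yb]; have [] := Hg a' y a'0 ay (le_lt_trans yb b'pi).
have Dg := loc_abs_cont_ae_derive a'b' ig' Hf'.
have gk : g = k %[ae mu in `[a, b]%classic].
  have FF := ae_filter_ringOfSetsType mu; apply: filterS2 Dg Hk.
  move=> y Dy ky; rewrite /= in_itv/= => /andP[ay yb].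
  rewrite -Dy ?ky//= ?in_itv/=.
    by rewrite (lt_le_trans a0 ay) (le_lt_trans yb).
  by rewrite (lt_le_trans aa ay) (le_lt_trans yb).
have ikab : mu.-integrable `[a, b] (EFin \o k).
  apply: continuous_compact_integrable; first exact: segment_compact.
  apply: continuous_in_subspaceT => y; rewrite inE/= in_itv/= => /andP[ay yb].
  by apply: ck; rewrite (lt_le_trans a0 ay) (le_lt_trans yb).
have fE y : a <= y <= b -> f y = f a + \int[mu]_(t in `[a, y]) k t.
  move=> /andP[ay yb]; have [igy E] := Hg a y a0 ay (le_lt_trans yb bpi).
  rewrite -[LHS](subrK (f a)) E addrC; congr (_ + _).
  rewrite /Rintegral; congr fine; apply: ae_eq_integral.
  - exact: measurable_itv.
  - exact: measurable_int igy.
  - apply: (measurable_funS _ _ (measurable_int _ ikab)) => //.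
    by apply: subset_itvl; rewrite bnd_simp.
  - have FF := ae_filter_ringOfSetsType mu; apply: filterS gk => t gkt /=.
    rewrite in_itv/= => /andP[at_ ty].
    by congr EFin; apply: gkt; rewrite /= in_itv/= at_ (le_trans ty).
have [DI EI] := continuous_FTC1_closed xb ikab ax (ck x x0pi).
have near_eq : \forall y \near x, f a + \int[mu]_(t in `[a, y]) k t = f y.
  have : \forall y \near x, a < y < b.
    near=> y; apply/andP; split; near: y; [exact: lt_nbhsr|exact: lt_nbhsl].
  by apply: filterS => y /andP[ay yb]; rewrite (fE y)// (ltW ay) ltW.
have D := is_deriveD (is_derive_cst (f a) x 1) (DeriveDef DI (etrans (esym (derive1E _ _)) EI)).
by have := near_eq_is_derive near_eq D; rewrite add0r.
Unshelve. all: by end_near. Qed.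

End AbsoluteContinuity.

(** * L2 bounds from pointwise bounds *)
Section L2Bounds.
Context {R : realType}.
Local Notation mu := (@lebesgue_measure R).

Definition singular_weight (s x : R) : R := x `^ (- s) + (pi - x) `^ (- s).

Lemma is_derive_singular_weight (p x : R) : p != 1 -> 0 < x < pi ->
  is_derive x 1 (fun y => 1 / (1 - p) * y `^ (1 - p) - 1 / (1 - p) * (pi - y) `^ (1 - p))
    (singular_weight p x).
Proof.
move=> p1 /andP[x0 xpi]; have p1' : 1 - p != 0 by rewrite subr_eq0 eq_sym.
have D1 := is_derive_scaled_powR 1 x0 p1'.
have xpi' : 0 < pi - x by rewrite subr_gt0.
have D2 := is_derive_reflect (is_derive_scaled_powR 1 xpi' p1').
apply: (is_derive_eq (is_deriveB D1 D2)).
by rewrite opprK !mul1r /singular_weight (_ : 1 - p - 1 = - p)//; ring.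
Qed.

Lemma derivable_singular_weight (p x : R) : 0 < x < pi ->
  derivable (singular_weight p) x 1.
Proof.
move=> /andP[x0 xpi]; have xpi' : 0 < pi - x by rewrite subr_gt0.
have D1 := is_derive1_powR (- p) x0.
have D2 := is_derive_reflect (is_derive1_powR (- p) xpi').
by have [] := is_deriveD D1 D2.
Qed.

Lemma singular_weight_ge0 (p x : R) : 0 <= singular_weight p x.
Proof. by rewrite addr_ge0// powR_ge0. Qed.

Lemma measurable_singular_weight (p : R) : measurable_fun `]0, pi[ (singular_weight p).
Proof.
apply: open_continuous_measurable_fun; first exact: interval_open.
move=> x; rewrite inE/= in_itv/= => x0pi.
by apply: differentiable_continuous; apply/derivable1_diffP/derivable_singular_weight.
Qed.

(** The primitive is bounded on [[0, pi]] as [p < 1], so that the integrals over an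
    exhausting sequence of segments are bounded. *)
Lemma singular_weight_integral (p : R) : 0 <= p < 1 ->
  (\int[mu]_(x in `]0%R, pi[) (singular_weight p x)%:E < +oo)%E.
Proof.
move=> /andP[p0 p1]; have pi2 := pi_ge2 R.
pose e (n : nat) : R := n.+2%:R^-1.
have e0 n : 0 < e n by rewrite invr_gt0.
have e1 n : e n <= 1 / 2 by rewrite /e div1r lef_pV2 ?posrE// ler_nat.
pose F n : set R := `[e n, pi - e n]%classic.
have FU : \bigcup_n F n = `]0%R, pi[%classic.
  apply/seteqP; split=> [x [n _]|x]; rewrite /F /= !in_itv/=.
    by move=> /andP[ex xe]; have := e0 n; lra.
  move=> /andP[x0 xpi].
  pose d := Num.min x (pi - x); have d0 : 0 < d by rewrite lt_min x0 subr_gt0.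
  exists (Num.truncn d^-1) => //; rewrite /F /= in_itv/=.
  have : e (Num.truncn d^-1) <= d.
    rewrite /e -[leRHS]invrK lef_pV2 ?posrE ?invr_gt0//.
    by apply/ltW/(lt_trans (truncnS_gt _)); rewrite ltr_nat.
  by rewrite le_min; lra.
have ndF : nondecreasing_seq F.
  move=> m n mn; rewrite subsetEset => x; rewrite /F /= !in_itv/= => /andP[ex xe].
  have : e n <= e m by rewrite /e lef_pV2 ?posrE// ler_nat !ltnS.
  by move=> ?; lra.
have Fsub n x : F n x -> 0 < x < pi.
  by rewrite /F /= in_itv/=; have := e0 n; lra.
pose G y := 1 / (1 - p) * y `^ (1 - p) - 1 / (1 - p) * (pi - y) `^ (1 - p).
have dG x : 0 < x < pi -> is_derive x 1 G (singular_weight p x).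
  by apply: is_derive_singular_weight; rewrite lt_eqF.
pose Q : R := 2 * (1 / (1 - p) * pi `^ (1 - p)).
have IF n : (\int[mu]_(x in F n) (singular_weight p x)%:E <= Q%:E)%E.
  have ee : e n < pi - e n by have := e1 n; lra.
  rewrite /F (continuous_FTC2 (F := G) ee).
  - rewrite -EFinB lee_fin /G.
    have pm y : 0 <= y <= pi -> 0 <= y `^ (1 - p) <= pi `^ (1 - p).
      move=> /andP[y0 ypi]; rewrite powR_ge0 ge0_ler_powR ?nnegrE ?pi_ge0//.
      by rewrite subr_ge0 ltW.
    have k0 : 0 < 1 / (1 - p) by rewrite divr_gt0// subr_gt0.
    have := pm (pi - e n); have := pm (pi - (pi - e n)); have := pm (e n).
    have := e0 n; have := e1 n; rewrite /Q; nra.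
  - apply: derivable_within_continuous => x xF.
    by apply: derivable_singular_weight; apply: (Fsub n).
  - have cG x : 0 < x < pi -> {for x, continuous G}.
      move=> x0pi; apply: differentiable_continuous; apply/derivable1_diffP.
      by have [] := dG x x0pi.
    have e0n := e0 n; have e1n := e1 n.
    split.
    + move=> x; rewrite in_itv/= => /andP[ex xe].
      by have [|//] := dG x _; lra.
    + by apply: cvg_at_right_filter; apply: cG; lra.
    + by apply: cvg_at_left_filter; apply: cG; lra.
  - move=> x; rewrite in_itv/= => /andP[ex xe]; have e0n := e0 n.
    by rewrite derive1E; have [|_ ->] := dG x _; lra.
have mF n : measurable (F n) by exact: measurable_itv.
have mf n : measurable_fun (F n) (EFin \o singular_weight p).
  apply/measurable_EFinP; apply: measurable_funS (measurable_singular_weight p) => //.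
  by move=> x /Fsub; rewrite /= in_itv.
have f0 n x : F n x -> (0 <= (EFin \o singular_weight p) x)%E.
  by move=> _; rewrite /= lee_fin singular_weight_ge0.
have := ge0_nondecreasing_set_cvg_integral (mu := mu) ndF mF mf f0.
rewrite FU => cI; apply: (@le_lt_trans _ _ Q%:E); last exact: ltry.
rewrite -(cvg_lim _ cI)//; apply: lime_le; first by apply/cvg_ex; eexists; exact: cI.
by apply: nearW => n; exact: IF.
Qed.

(** Made for the pointwise interpolation error, about whose measurability nothing
    is established: the integral of a nonnegative function is by definition the
    supremum of those of the simple functions below it. *)
Lemma le_integral_nonmeasurable (D : set R) (f g : R -> \bar R) :
  (forall x, D x -> (0 <= f x <= g x)%E) ->
  (\int[mu]_(x in D) f x <= \int[mu]_(x in D) g x)%E.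
Proof.
move=> fg; have f0 x : D x -> (0 <= f x)%E by move=> /fg /andP[].
have g0 x : D x -> (0 <= g x)%E by move=> /fg /andP[]; exact: le_trans.
rewrite !ge0_integralE//; apply: le_ereal_sup => _ [h hf <-]; exists h => // x.
apply: le_trans (hf x) _; rewrite !patchE; case: ifPn => // /set_mem Dx.
by case/andP: (fg x Dx).
Qed.

(** The exceptional set [N] is meant for the mesh points, at which an interpolant
    has no derivative. *)
Lemma L2norm_le_weight (s : R) : 0 <= s < 1 / 2 ->
  exists2 W : R, 0 <= W & forall (w : R -> 'cV[R[i]]_2) (N : set R) (B : R),
    countable N -> 0 <= B ->
    (forall x, 0 < x < pi -> ~ N x ->
       \sum_(i < 2) complex.Re `|w x i ord0| ^+ 2 <= (B * singular_weight s x) ^+ 2) ->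
    (L2norm w <= (W * B)%:E)%E.
Proof.
move=> /andP[s0 s2].
have I0 : (0 <= \int[mu]_(x in `]0%R, pi[) (singular_weight (2 * s) x)%:E)%E.
  by apply: integral_ge0 => x _; rewrite lee_fin singular_weight_ge0.
have [I Ifin] : exists I : R,
    (\int[mu]_(x in `]0%R, pi[) (singular_weight (2 * s) x)%:E)%E = I%:E.
  have : 0 <= 2 * s < 1 by lra.
  move=> /singular_weight_integral; move: I0.
  by case: (integral _ _ _) => [r _ _| |] //; exists r.
rewrite Ifin lee_fin in I0.
exists (Num.sqrt (2 * I)); first exact: sqrtr_ge0.
move=> w N B cN B0 H; rewrite /L2norm.
pose g x : R := B ^+ 2 * 2 * singular_weight (2 * s) x.
(* Infinite on [N], where the integrand is arbitrary. *)
pose g' x : \bar R := if x \in N then +oo%E else (g x)%:E.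
have g0 x : 0 <= g x by rewrite !mulr_ge0 ?sqr_ge0// singular_weight_ge0.
have mN : measurable N by apply: countable_measurable cN; exact: measurable_set1.
have sq_weight x : singular_weight s x ^+ 2 <= 2 * singular_weight (2 * s) x.
  rewrite /singular_weight -mulrN 2!(mulrC 2) 2!powRrM.
  rewrite !powR_mulrn ?powR_ge0//.
  by have := sqr_ge0 (x `^ (- s) - (pi - x) `^ (- s)); nra.
have mg : measurable_fun `]0, pi[ g.
  by apply: measurable_funM => //; exact: measurable_singular_weight.
have Ig : (\int[mu]_(x in `]0%R, pi[) g' x = (B ^+ 2 * 2 * I)%:E)%E.
  transitivity (\int[mu]_(x in `]0%R, pi[) (g x)%:E)%E.
    apply: ae_eq_integral => //.
    + apply: measurable_fun_if => //.
      * apply: (measurable_fun_bool true); apply: measurableI => //.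
        rewrite (_ : _ @^-1` _ = N)//; apply/seteqP; split=> x /=; first by move/set_mem.
        by move=> /mem_set ->.
      * apply: measurable_funS (_ : measurable_fun `]0, pi[ (EFin \o g)) => //.
        exact/measurable_EFinP.
    + exact/measurable_EFinP.
    + exists N; split => //; first exact: countable_lebesgue_measure0.
      move=> x /=; apply: contra_notP => Nx _; rewrite /g' memNset//.
  rewrite /g; under eq_integral do rewrite EFinM.
  rewrite ge0_integralZl_EFin ?Ifin//.
  - by move=> x _; rewrite lee_fin singular_weight_ge0.
  - by apply/measurable_EFinP; exact: measurable_singular_weight.
  - by rewrite mulr_ge0// sqr_ge0.
have le1 : (\int[mu]_(x in `]0%R, pi[)
   (\sum_(i < 2) complex.Re `|w x i ord0| ^+ 2)%:E <= (B ^+ 2 * 2 * I)%:E)%E.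
  rewrite -Ig; apply: le_integral_nonmeasurable => x /=; rewrite in_itv/= => x0pi.
  rewrite lee_fin sumr_ge0 /=; last by move=> i _; exact: sqr_ge0.
  rewrite /g'; case: ifPn => [_|]; first exact: leey.
  rewrite notin_setE => Nx; rewrite lee_fin.
  apply: le_trans (H x x0pi Nx) _; rewrite exprMn /g -mulrA ler_wpM2l ?sqr_ge0//.
apply: (@le_trans _ _ ((B ^+ 2 * 2 * I)%:E `^ 2^-1)%E).
  apply: gt0_ler_poweR => //.
  - rewrite in_itv/= leey andbT; apply: integral_ge0 => x _.
    by rewrite lee_fin sumr_ge0// => i _; exact: sqr_ge0.
  - by rewrite in_itv/= leey andbT lee_fin !mulr_ge0 ?sqr_ge0.
rewrite poweR_EFin powR12_sqrt ?mulr_ge0 ?sqr_ge0// lee_fin.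
by rewrite -mulrA sqrtrM ?sqr_ge0// sqrtr_sqr ger0_norm// mulrC.
Qed.

End L2Bounds.

(** * Systems singular at both ends of the interval *)
Section TwoEnds.
Context {R : realType} (T : finType).
Implicit Types (F : T -> R -> R) (s : T -> R) (B : T -> T -> R -> R).

Definition system_rhs s B F t x :=
  s t * (1 / x + 1 / (pi - x)) * F t x + \sum_j B t j x * F j x.

(** The pairs of a rate [r] and a weight exponent [sg] for which the two mesh
    estimates, in this order, bound the error by [h `^ r * x `^ (- sg)]. *)
Definition admissible_rate (al r sg : R) : Prop :=
  [/\ 0 <= r <= 1, 0 <= sg & r + 1 - sg <= al] \/ [/\ al = 1, r = 1 & sg = 0].

(** At distance from [pi] the term [1 / (pi - x)] is bounded and Lipschitz, and
    joins the coupling matrix.  The range is [3 / 4 * pi] because a mesh cell of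
    width at most [pi / 4] that crosses the midpoint must lie in it. *)
Lemma mesh_error_left_end F s B (al K r sg : R) (Phi : R -> R) :
  1 / 2 < al -> (forall t, s t = al \/ s t = - al) ->
  (forall t x, 0 < x < pi -> is_derive x 1 (F t) (system_rhs s B F t x)) ->
  (forall t t' x, 0 < x < pi -> `|B t t' x| <= K) ->
  (forall t t' x y, 0 < x < pi -> 0 < y < pi ->
     `|B t t' x - B t t' y| <= K * `|x - y|) ->
  (forall x, 0 < x < pi -> is_derive x 1 Phi (\sum_t F t x ^+ 2)) ->
  (forall x, 0 < x < pi -> 0 <= Phi x) ->
  admissible_rate al r sg ->
  exists2 C, 0 <= C &
    forall t, mesh_error_le (F t) (system_rhs s B F t) (3 / 4 * pi) r sg C.
Proof.
move=> al2 sal dF bB lB dPhi Phi0 rate; have pi2 := pi_ge2 R.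
pose c : R := 3 / 4 * pi; have c0 : 0 < c by rewrite /c; lra.
have cpi x : 0 < x <= c -> 0 < x < pi by rewrite /c; lra.
pose B' t t' x := B t t' x + (t == t')%:R * (s t * (1 / (pi - x))).
pose K' := K + 4 * al.
have rhsE t x : 0 < x <= c -> system_rhs s B F t x = s t / x * F t x + \sum_j B' t j x * F j x.
  move=> /cpi x0pi; rewrite /B'.
  under [in RHS]eq_bigr do rewrite mulrDl.
  rewrite big_split/=.
  have -> : \sum_j (t == j)%:R * (s t * (1 / (pi - x))) * F j x =
      s t * (1 / (pi - x)) * F t x.
    rewrite (bigD1 t)//= eqxx big1 ?addr0 ?mul1r// => j /negbTE jt.
    by rewrite eq_sym jt !mul0r.
  by rewrite /system_rhs; ring.
have nsal t : `|s t| = al by case: (sal t) => ->; rewrite ?normrN ger0_norm//; lra.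
have inv2 x : 0 < x <= c -> 0 < 1 / (pi - x) <= 2.
  move=> xc; have x1 : 1 / 2 <= pi - x by move: xc; rewrite /c; lra.
  rewrite divr_gt0//=; last by lra.
  by rewrite ler_pdivrMr; lra.
have dF' t x : 0 < x <= c -> is_derive x 1 (F t) (s t / x * F t x + \sum_j B' t j x * F j x).
  by move=> xc; rewrite -rhsE//; exact/dF/cpi.
have bB' t t' x : 0 < x <= c -> `|B' t t' x| <= K'.
  move=> xc; apply: le_trans (ler_normD _ _) _; rewrite lerD// ?bB//; first exact: cpi.
  have := inv2 _ xc; rewrite normrM (normrM (s t)) nsal => /andP[i0 i2].
  rewrite (gtr0_norm i0); case: (t == t'); rewrite ?normr1 ?normr0; nra.
have lB' t t' x y : 0 < x <= c -> 0 < y <= c -> `|B' t t' x - B' t t' y| <= K' * `|x - y|.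
  move=> xc yc.
  have -> : B' t t' x - B' t t' y = (B t t' x - B t t' y) +
     (t == t')%:R * s t * (1 / (pi - x) - 1 / (pi - y)) by rewrite /B'; ring.
  apply: le_trans (ler_normD _ _) _; rewrite /K' mulrDl lerD//.
    by apply: lB; exact: cpi.
  have /andP[ix ix2] := inv2 _ xc; have /andP[iy iy2] := inv2 _ yc.
  have -> : 1 / (pi - x) - 1 / (pi - y) = (1 / (pi - x)) * (1 / (pi - y)) * (x - y).
    have := cpi _ xc; have := cpi _ yc => ? ?.
    by field; rewrite !subr_eq0 !gt_eqF//; lra.
  rewrite normrM (normrM _ (s t)) nsal (normrM _ (x - y)) (normrM (1 / (pi - x))).
  rewrite (gtr0_norm ix) (gtr0_norm iy) mulrA ler_wpM2r//.
  case: (t == t'); rewrite ?normr1 ?normr0 ?mul0r ?mul1r; last by lra.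
  rewrite mulrC ler_wpM2r//; first by lra.
  have -> : (4 : R) = 2 * 2 by ring.
  by rewrite !div1r in ix ix2 iy iy2; rewrite ler_pM ?(ltW ix) ?(ltW iy).
have dPhi' x : 0 < x <= c -> is_derive x 1 Phi (\sum_t F t x ^+ 2) by move/cpi; exact: dPhi.
have Phi0' x : 0 < x <= c -> 0 <= Phi x by move/cpi; exact: Phi0.
have pb0 := energy_bound c0 al2 sal dF' bB' dPhi' Phi0'.
have pb := square_integrable_power_bounded c0 al2 sal dF' bB' pb0.
have D t x : 0 < x <= c -> is_derive x 1 (F t) (system_rhs s B F t x).
  by move/cpi; exact: dF.
case: rate => [[r01 sg0 gal]|[al1 -> ->]]; last first.
  rewrite al1 in pb.
  have [C C0 HC] := pb.
  have [C' C'0 HC'] := derivative_lipschitz c0 al2 sal dF' bB' lB' al1 pb.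
  exists (C + C'); first exact: addr_ge0.
  move=> t; apply: mesh_error_lipschitz; first exact: addr_ge0.
  - move=> x /[dup] xc /andP[x0 _]; apply: le_trans (HC t x xc) _.
    by rewrite powRr1 ?(ltW x0)// ler_wpM2r ?(ltW x0)// lerDl.
  - move=> x y x0 xy yc; rewrite !rhsE ?x0 ?yc ?(lt_le_trans x0) ?(le_trans xy)//.
    apply: le_trans (HC' t x y x0 xy yc) _.
    by rewrite ler_wpM2r ?subr_ge0// lerDr.
set g := r + 1 - sg in gal.
have pg := power_boundedW gal pb; have [C C0 HC] := pg.
have g2 : g <= 2 by rewrite /g; lra.
have [C1 C10 HC1] := derivative_power c0 al2 sal bB' pg.
have [C2 C20 HC2] := derivative_lipschitz_power c0 al2 sal dF' bB' lB' g2 pg.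
pose Q := C + C1 + C2.
have [CQ C1Q C2Q] : [/\ C <= Q, C1 <= Q & C2 <= Q] by rewrite /Q; split; lra.
have Q0 : 0 <= Q by exact: le_trans CQ.
exists ((2 + 2 `^ (2 - g)) * Q); first by rewrite mulr_ge0// addr_ge0// powR_ge0.
move=> t; apply: mesh_error_power => //.
- by rewrite /g; ring.
- by move=> x xc; apply: le_trans (HC t x xc) _; rewrite ler_wpM2r ?powR_ge0.
- move=> x xc; rewrite rhsE//; apply: le_trans (HC1 t x xc) _.
  by rewrite ler_wpM2r ?powR_ge0.
- move=> x y x0 xy yc; rewrite !rhsE ?x0 ?yc ?(lt_le_trans x0) ?(le_trans xy)//.
  apply: le_trans (HC2 t x y x0 xy yc) _.
  by rewrite ler_wpM2r ?subr_ge0// ler_wpM2r ?powR_ge0.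
Qed.

(** The reflection [x |-> pi - x] changes the signs of [s], [B] and of the
    derivative, and a bounded primitive becomes its bound minus its reflection. *)
Lemma mesh_error_right_end F s B (al K r sg M : R) (Phi : R -> R) :
  1 / 2 < al -> (forall t, s t = al \/ s t = - al) ->
  (forall t x, 0 < x < pi -> is_derive x 1 (F t) (system_rhs s B F t x)) ->
  (forall t t' x, 0 < x < pi -> `|B t t' x| <= K) ->
  (forall t t' x y, 0 < x < pi -> 0 < y < pi ->
     `|B t t' x - B t t' y| <= K * `|x - y|) ->
  (forall x, 0 < x < pi -> is_derive x 1 Phi (\sum_t F t x ^+ 2)) ->
  (forall x, 0 < x < pi -> Phi x <= M) ->
  admissible_rate al r sg ->
  exists2 C, 0 <= C &
    forall t, mesh_error_le (fun x => F t (pi - x))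
      (fun x => - system_rhs s B F t (pi - x)) (3 / 4 * pi) r sg C.
Proof.
move=> al2 sal dF bB lB dPhi PhiM rate.
have pix x : 0 < x < pi -> 0 < pi - x < pi by lra.
pose F' t x := F t (pi - x); pose s' t := - s t; pose B' t t' x := - B t t' (pi - x).
have rhsE t x : - system_rhs s B F t (pi - x) = system_rhs s' B' F' t x.
  rewrite /system_rhs /s' /B' /F' (_ : pi - (pi - x) = x); last by ring.
  under [in RHS]eq_bigr do rewrite mulNr.
  by rewrite sumrN; ring.
have [|t x|t t' x|t t' x y|x|x||C C0 HC] := @mesh_error_left_end F' s' B' al K r sg
   (fun x => M - Phi (pi - x)) al2.
- by move=> t; rewrite /s'; case: (sal t) => ->; [right|left]; rewrite ?opprK.
- by move=> /pix xpi; rewrite -rhsE; apply: is_derive_reflect; exact: dF.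
- by move=> /pix xpi; rewrite normrN bB.
- move=> /pix xpi /pix ypi; rewrite /B' -opprD normrN.
  by apply: le_trans (lB _ _ _ _ xpi ypi) _; rewrite (_ : _ - _ = y - x) 1?distrC//; ring.
- move=> /pix xpi; have D := is_derive_reflect (dPhi _ xpi).
  have := is_deriveB (is_derive_cst M x 1) D; rewrite sub0r opprK; exact.
- by move=> /pix xpi; rewrite subr_ge0 PhiM.
- exact: rate.
exists C => // t; have := HC t.
by rewrite (_ : system_rhs s' B' F' t = fun x => - system_rhs s B F t (pi - x))//;
  apply/funext => x.
Qed.

End TwoEnds.

(** * The eigenfunction as a real first-order system *)
Section Eigenfunction.
Context {R : realType}.
Local Notation mu := (@lebesgue_measure R).
Implicit Types (u v : R -> 'cV[R[i]]_2) (V : R[i] -> 'M[R[i]]_2).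

Definition row_index (i : bool) : 'I_2 := if i then ord_max else ord0.

Definition component u (t : bool * bool) (x : R) : R :=
  part t.2 (u x (row_index t.1) ord0).

(** The entries of multiplication by [z], as a real matrix acting on the real
    and imaginary parts. *)
Definition mul_entry (b b' : bool) (z : R[i]) : R :=
  (-1) ^+ (~~ b && b') * part (b (+) b') z.

Lemma partM b (z w : R[i]) :
  part b (z * w) = mul_entry b false z * part false w + mul_entry b true z * part true w.
Proof. by case: b z w => -[? ?] [? ?]; rewrite /mul_entry /part/=; ring. Qed.

Lemma part_sign b (i : bool) (z : R[i]) : part b ((-1) ^+ i * z) = (-1) ^+ i * part b z.
Proof. by case: i; rewrite ?expr0 ?expr1 ?mulN1r ?mul1r//; case: b z => -[? ?]. Qed.

Lemma mul_entryB b b' (z w : R[i]) :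
  mul_entry b b' (z - w) = mul_entry b b' z - mul_entry b b' w.
Proof. by rewrite /mul_entry partB mulrBr. Qed.

Lemma mul_entry0 b b' : mul_entry b b' 0 = 0.
Proof. by rewrite /mul_entry /part; case: (b (+) b'); rewrite mulr0. Qed.

Lemma mul_entry_sign b b' (i : bool) (z : R[i]) :
  mul_entry b b' ((-1) ^+ i * z) = (-1) ^+ i * mul_entry b b' z.
Proof. by rewrite /mul_entry part_sign mulrCA. Qed.

(** The row of the differential expression that contains the derivative of the
    component [i] is the other one, [~~ i], and it comes with the sign
    [(-1) ^+ (~~ i)]. *)
Definition system_entry V (lambda : R[i]) (t t' : bool * bool) (x : R) : R :=
  mul_entry t.2 t'.2 ((-1) ^+ t.1 *
    (V x%:C (row_index (~~ t.1)) (row_index t'.1) - lambda *+ (~~ t.1 == t'.1))).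

Definition system_sign (kappa : R) (t : bool * bool) : R := (-1) ^+ t.1 * kappa.

Lemma sum_bool2 (f : bool * bool -> R) :
  \sum_t f t = \sum_(i : bool) \sum_(b : bool) f (i, b).
Proof. by rewrite (pair_bigA _ (fun i b => f (i, b))); apply: eq_bigr => -[]. Qed.

Lemma weight_split (kappa x : R) : 0 < x < pi ->
  pi * kappa / (x * (pi - x)) = kappa * (1 / x + 1 / (pi - x)).
Proof.
by move: (@pi R) => p /andP[x0 xp]; field; rewrite subr_eq0 (gt_eqF xp) (gt_eqF x0).
Qed.

Lemma part_diff_expr kappa V u x i b : 0 < x < pi ->
  part b (diff_expr kappa V u x (row_index i) ord0) =
  (-1) ^+ i * derive1 (component u (~~ i, b)) x +
  kappa * (1 / x + 1 / (pi - x)) * component u (~~ i, b) x +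
  \sum_(j : bool) \sum_(b' : bool)
    mul_entry b b' (V x%:C (row_index i) (row_index j)) * component u (j, b') x.
Proof.
move=> x0pi; rewrite -(weight_split _ x0pi) !big_bool /diff_expr !mxE partD.
rewrite big_ord_recl big_ord1 partD (_ : lift ord0 ord0 = ord_max); last exact: val_inj.
rewrite !partM.
set w := _ / _.
rewrite /component /mul_entry /part /cderive.
case: i b => -[] /=; rewrite ?expr0 ?expr1; case: (u x ord0 ord0) (u x ord_max ord0);
  by move=> a1 b1 [a2 b2] /=; ring.
Qed.

Lemma component_loc_abs_cont u t : real_parts loc_abs_cont u -> loc_abs_cont (component u t).
Proof. by case: t => i b /(_ (row_index i)) []; case: b. Qed.

Lemma eigenfunction_ae_system kappa V lambda u :
  diff_expr kappa V u = (fun x => lambda *: u x) %[ae mu in `]0, pi[%classic] ->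
  forall t, derive1 (component u t) = system_rhs (system_sign kappa)
    (system_entry V lambda) (component u) t %[ae mu in `]0, pi[%classic].
Proof.
move=> heig [i b]; have FF := ae_filter_ringOfSetsType mu.
apply: filterS heig => x Hx xpi; have := Hx xpi; move: xpi; rewrite /= in_itv/= => x0pi.
move=> /(congr1 (fun z : 'cV[R[i]]_2 => part b (z (row_index (~~ i)) ord0))).
rewrite (part_diff_expr _ _ _ _ _ x0pi) negbK mxE partM.
rewrite /system_rhs /system_sign /system_entry sum_bool2 !big_bool /=.
rewrite !mul_entry_sign !mul_entryB.
case: i {Hx} => /=; rewrite ?mulr1n ?mulr0n ?mul_entry0 ?subr0 ?expr0 ?expr1 => E;
  rewrite /component/= in E *; lra.
Qed.

Lemma norm_mul_entry b b' (z : R[i]) : `|mul_entry b b' z| = `|part (b (+) b') z|.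
Proof. by rewrite /mul_entry normrM normr_sign mul1r. Qed.

Lemma system_entry_bounds V lambda : analytic_hermitian_potential V ->
  exists2 K, 0 <= K & forall t t',
    (forall x, 0 < x < pi -> `|system_entry V lambda t t' x| <= K) /\
    (forall x y, 0 < x < pi -> 0 < y < pi ->
       `|system_entry V lambda t t' x - system_entry V lambda t t' y| <= K * `|x - y|).
Proof.
move=> /potential_lipschitz[K K0 HK]; pose L := complex.Re `|lambda|.
have L0 : 0 <= L by apply: le_trans (part_le false lambda); exact: normr_ge0.
exists (K + L); first exact: addr_ge0.
move=> t t'; have [H1 H2] := HK (row_index (~~ t.1)) (row_index t'.1) (t.2 (+) t'.2).
have cl (x : R) : 0 < x < pi -> 0 <= x <= pi by lra.
split=> [x /cl x0pi|x y /cl x0pi /cl y0pi]; rewrite /system_entry !mul_entry_sign !mul_entryB.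
  rewrite normrM normr_sign mul1r; apply: le_trans (ler_normB _ _) _.
  rewrite !norm_mul_entry lerD ?H1//; case: eqP => _; first by rewrite mulr1n part_le.
  by rewrite mulr0n /part; case: (_ (+) _); rewrite normr0.
rewrite -mulrBr normrM normr_sign mul1r opprB addrA subrK.
rewrite -mul_entryB norm_mul_entry partB; apply: le_trans (H2 _ _ x0pi y0pi) _.
by rewrite ler_wpM2r// lerDl.
Qed.

Lemma lipschitz_continuous_at (f : R -> R) (K x : R) : 0 < x < pi ->
  (forall y, 0 < y < pi -> `|f x - f y| <= K * `|x - y|) -> {for x, continuous f}.
Proof.
move=> /andP[x0 xpi] H; apply/cvgrPdist_le => e e0.
have K1 : 0 < `|K| + 1 by rewrite ltr_wpDl.
near=> y; apply: le_trans (H y _) _.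
  by apply/andP; split; near: y; [exact: lt_nbhsr|exact: lt_nbhsl].
have xy : `|x - y| <= e / (`|K| + 1).
  near: y; have d0 : 0 < e / (`|K| + 1) by rewrite divr_gt0.
  by apply: filterS (nbhsx_ballx x _ d0) => y; rewrite -ball_normE /= => /ltW.
move: xy; rewrite ler_pdivlMr// => xy.
by have := normr_ge0 (x - y); have := ler_norm K; nra.
Unshelve. all: by end_near. Qed.

Lemma continuous_sum_at (T : finType) (f : T -> R -> R) (x : R) :
  (forall t, {for x, continuous (f t)}) -> {for x, continuous (fun y => \sum_t f t y)}.
Proof.
move=> H; have -> : (fun y => \sum_t f t y) = \sum_t f t.
  by apply/funext => y; rewrite fct_sumE.
apply: (big_ind (fun g : R -> R => {for x, continuous g})) => //; first exact: cvg_cst.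
by move=> g1 g2 c1 c2; exact: (cvgD c1 c2).
Qed.

Lemma eigenfunction_system kappa V lambda u :
  analytic_hermitian_potential V -> real_parts loc_abs_cont u ->
  diff_expr kappa V u = (fun x => lambda *: u x) %[ae mu in `]0, pi[%classic] ->
  forall t x, 0 < x < pi -> is_derive x 1 (component u t)
    (system_rhs (system_sign kappa) (system_entry V lambda) (component u) t x).
Proof.
move=> anV acu heig t.
have [K K0 HK] := system_entry_bounds lambda anV.
apply: loc_abs_cont_is_derive; last exact: eigenfunction_ae_system.
  exact: component_loc_abs_cont.
have cu t' x : 0 < x < pi -> {for x, continuous (component u t')}.
  by apply: loc_abs_cont_continuous; exact: component_loc_abs_cont.
move=> x /[dup] x0pi /andP[x0 xpi]; rewrite /system_rhs.
apply: cvgD.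
  apply: cvgM; last exact: cu.
  apply: cvgM; first exact: cvg_cst.
  apply: cvgD; apply: cvgM; (try exact: cvg_cst); apply: cvgV.
  - by rewrite gt_eqF.
  - exact: cvg_id.
  - by rewrite subr_eq0 gt_eqF.
  - by apply: cvgB; [exact: cvg_cst|exact: cvg_id].
apply: continuous_sum_at => t'; apply: cvgM; last exact: cu.
apply: (@lipschitz_continuous_at _ K x x0pi) => y y0pi.
by have [_] := HK t t'; apply.
Qed.

Lemma sqr_Re_norm (z : R[i]) :
  complex.Re `|z| ^+ 2 = part false z ^+ 2 + part true z ^+ 2.
Proof. by case: z => x y; rewrite normc_def/= sqr_sqrtr// addr_ge0 ?sqr_ge0. Qed.

Lemma sum_sqr_component u x : \sum_(i < 2) complex.Re `|u x i ord0| ^+ 2 =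
  \sum_t component u t x ^+ 2.
Proof.
rewrite sum_bool2 !big_bool /= big_ord_recl big_ord1.
rewrite (_ : lift ord0 ord0 = ord_max); last exact: val_inj.
by rewrite !sqr_Re_norm /component/=; ring.
Qed.

(** Square integrability enters the estimates only through this bounded,
    nonnegative primitive. *)
Lemma square_integral_primitive u : in_L2 u -> real_parts loc_abs_cont u ->
  exists M (Phi : R -> R), forall x, 0 < x < pi ->
    [/\ is_derive x 1 Phi (\sum_t component u t x ^+ 2), 0 <= Phi x & Phi x <= M].
Proof.
move=> [_ L2u] acu; pose f x := \sum_t component u t x ^+ 2.
have f0 x : 0 <= f x by apply: sumr_ge0 => t _; exact: sqr_ge0.
have cf x : 0 < x < pi -> {for x, continuous f}.
  move=> x0pi; apply: continuous_sum_at => t; apply: cvgM;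
    by apply: loc_abs_cont_continuous x0pi; exact: component_loc_abs_cont.
have mf : measurable_fun `]0, pi[ f.
  apply: open_continuous_measurable_fun; first exact: interval_open.
  by move=> x; rewrite inE/= in_itv/=; exact: cf.
have fi : mu.-integrable `]0, pi[ (EFin \o f).
  apply/integrableP; split; first exact/measurable_EFinP.
  under eq_integral do rewrite /= ger0_norm//.
  move: L2u; rewrite /L2norm; have h0 : 2^-1 != 0 :> R by [].
  move=> /(lty_poweRy h0); congr (_ < _)%E.
  by apply: eq_integral => x _; rewrite sum_sqr_component.
pose Phi x := \int[mu]_(y in `]0, x]) f y.
exists (\int[mu]_(y in `]0%R, pi[) f y), Phi => x /[dup] x0pi /andP[x0 xpi].
have sub y : y < pi -> (`]0, y] `<=` `]0, pi[)%classic.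
  by move=> ypi z /=; rewrite !in_itv/= => /andP[-> zy]; rewrite (le_lt_trans zy).
have fiy y : y < pi -> mu.-integrable `]0, y] (EFin \o f).
  by move=> /sub ysub; apply: integrableS fi => //; exact: measurable_itv.
pose b := (x + pi) / 2; have [xb bpi] : x < b /\ b < pi by rewrite /b; split; lra.
have [] := @continuous_FTC1 R f (BRight 0) x b xb (fiy b bpi) _ (cf x x0pi).
  by rewrite /= lte_fin.
move=> DPhi EPhi; split.
- by apply: (DeriveDef DPhi); rewrite -derive1E.
- by apply: Rintegral_ge0 => y _; exact: f0.
- rewrite /Phi /Rintegral fine_le//.
  + exact: integrable_fin_num (fiy x xpi).
  + exact: integrable_fin_num fi.
  + apply: ge0_subset_integral => //; last exact: sub.
    * exact/measurable_EFinP.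
    * by move=> y _; rewrite lee_fin f0.
Qed.

Lemma eigenfunction_mesh_error kappa V lambda u r sg :
  analytic_hermitian_potential V -> in_dom kappa V u ->
  diff_expr kappa V u = (fun x => lambda *: u x) %[ae mu in `]0, pi[%classic] ->
  1 / 2 < `|kappa| -> admissible_rate `|kappa| r sg ->
  let du t := system_rhs (system_sign kappa) (system_entry V lambda) (component u) t in
  exists2 C, 0 <= C & forall t,
    mesh_error_le (component u t) (du t) (3 / 4 * pi) r sg C /\
    mesh_error_le (fun x => component u t (pi - x)) (fun x => - du t (pi - x))
      (3 / 4 * pi) r sg C.
Proof.
move=> anV [L2u acu _] heig k2 rate du.
have [K K0 HK] := system_entry_bounds lambda anV.
have sys := eigenfunction_system anV acu heig.
have [M [Phi HPhi]] := square_integral_primitive L2u acu.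
have signs t : system_sign kappa t = `|kappa| \/ system_sign kappa t = - `|kappa|.
  rewrite /system_sign; case: t.1; rewrite ?expr0 ?expr1 ?mul1r ?mulN1r;
  case: (ger0P kappa) => _; rewrite ?opprK; by [left|right].
have [C1 C10 H1] := mesh_error_left_end k2 signs sys (fun t t' => (HK t t').1)
  (fun t t' => (HK t t').2) (fun x xpi => let: And3 a _ _ := HPhi x xpi in a)
  (fun x xpi => let: And3 _ a _ := HPhi x xpi in a) rate.
have [C2 C20 H2] := mesh_error_right_end k2 signs sys (fun t t' => (HK t t').1)
  (fun t t' => (HK t t').2) (fun x xpi => let: And3 a _ _ := HPhi x xpi in a)
  (fun x xpi => let: And3 _ _ a := HPhi x xpi in a) rate.
exists (C1 + C2); first exact: addr_ge0.
by move=> t; split; [apply: mesh_error_leW (H1 t)|apply: mesh_error_leW (H2 t)];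
  rewrite ?lerDl ?lerDr.
Qed.

End Eigenfunction.

(** * The interpolation error *)
Section InterpolationError.
Context {R : realType}.
Implicit Types (u v : R -> 'cV[R[i]]_2) (V : R[i] -> 'M[R[i]]_2).

Lemma componentB u v t x :
  component (fun y => u y - v y) t x = component u t x - component v t x.
Proof. by rewrite /component !mxE partB. Qed.

Lemma component0 v t x : v x = 0 -> component v t x = 0.
Proof. by rewrite /component => ->; rewrite mxE /part; case: t.2. Qed.

Lemma component_affine v t (a b : 'cV[R[i]]_2) (x : R) : v x = a + x%:C *: b ->
  component v t x = part t.2 (a (row_index t.1) ord0) +
                    x * part t.2 (b (row_index t.1) ord0).
Proof. by rewrite /component => ->; rewrite !mxE partD (mulrC x%:C) part_real mulrC. Qed.

Lemma is_derive_affine (f : R -> R) (A B a b x : R) : a < x < b ->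
  (forall y, a <= y <= b -> f y = A + y * B) -> is_derive x 1 f B.
Proof.
move=> /andP[ax xb] H; have D : is_derive x 1 (fun y => A + B * y) B.
  have D : is_derive x 1 (fun y => A + B * y) _ :=
    is_deriveD (is_derive_cst A x 1) (is_derive_mulc B x).
  by apply: (is_derive_eq D); rewrite add0r.
apply: near_eq_is_derive D; near=> y; rewrite mulrC H//.
by apply/andP; split; apply: ltW; near: y; [exact: lt_nbhsr|exact: lt_nbhsl].
Unshelve. all: by end_near. Qed.

Lemma nodeE n j : node n j = j%:R * (pi / n%:R) :> R.
Proof. by rewrite /node mulrA. Qed.

Lemma mesh_cell (n : nat) (x : R) : (0 < n)%N -> 0 < x < pi ->
  ~ range (@node R n) x ->
  exists2 j, (j < n)%N & j%:R * (pi / n%:R) < x < j.+1%:R * (pi / n%:R).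
Proof.
move=> n0 /andP[x0 xpi] xN; set h := pi / n%:R.
have h0 : 0 < h by rewrite divr_gt0 ?pi_gt0 ?ltr0n.
have xh0 : 0 <= x / h by rewrite divr_ge0 ?ltW.
have := truncn_itv xh0; set j := Num.truncn _.
rewrite ler_pdivlMr// ltr_pdivrMr// => /andP[jx xj].
exists j.
  rewrite -(ltr_nat R) -(ltr_pM2r h0); apply: le_lt_trans jx _.
  by rewrite /h mulrC divfK ?pnatr_eq0 ?lt0n_neq0// gt_eqF// ltr0n.
rewrite xj andbT lt_neqAle jx andbT; apply/eqP => jxE.
by apply: xN; exists j => //; rewrite nodeE.
Qed.

(** Every cell lies in [[0, 3 / 4 * pi]] or in its reflection, where the estimate
    for the corresponding end applies.  Dividing by the distance to that end
    accounts for the singular coefficient, the other summand of which is bounded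
    there. *)
Lemma component_error u (du : bool * bool -> R -> R) (r sg C : R) (n : nat) v t x :
  0 <= C -> (4 <= n)%N -> nodal_interpolant n u v -> 0 < x < pi ->
  ~ range (@node R n) x ->
  (forall y, 0 < y < pi -> is_derive y 1 (component u t) (du t y)) ->
  mesh_error_le (component u t) (du t) (3 / 4 * pi) r sg C ->
  mesh_error_le (fun x => component u t (pi - x)) (fun x => - du t (pi - x))
      (3 / 4 * pi) r sg C ->
  let D := C * (pi / n%:R) `^ r * singular_weight sg x in
  [/\ `|derive1 (component u t) x - derive1 (component v t) x| <= D,
      `|component u t x - component v t x| <= 6 * D &
      (1 / x + 1 / (pi - x)) * `|component u t x - component v t x| <= 6 * D].
Proof.
move=> C0 n4 [[_ v0 vpi vaff] vnode] x0pi xN dU mL mR D.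
have n0 : (0 < n)%N by exact: leq_trans n4.
have [j jn] := mesh_cell n0 x0pi xN; set h := pi / n%:R => xj.
have h0 : 0 < h by rewrite divr_gt0 ?pi_gt0 ?ltr0n.
have nh : n%:R * h = pi by rewrite /h mulrC divfK// gt_eqF// ltr0n.
have h4 : h <= pi / 4 by rewrite /h ler_pM2l ?pi_gt0// lef_pV2 ?posrE ?ltr0n// ler_nat.
have [a [b Hab]] := vaff j jn.
pose A := part t.2 (a (row_index t.1) ord0); pose B := part t.2 (b (row_index t.1) ord0).
have vE y : j%:R * h <= y <= j.+1%:R * h -> component v t y = A + y * B.
  by move=> yj; apply: component_affine; apply: Hab; rewrite !nodeE.
have dv : derive1 (component v t) x = B.
  by have [_ <-] := is_derive_affine xj vE; rewrite derive1E.
have du_x : derive1 (component u t) x = du t x.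
  by have [_ <-] := dU x x0pi; rewrite derive1E.
have vu k : (0 < k < n)%N -> component v t (k%:R * h) = component u t (k%:R * h).
  by move=> kn; rewrite /component -nodeE vnode.
have jj : j%:R * h < j.+1%:R * h by rewrite ltr_pM2r// ltr_nat.
have xj' : j%:R * h <= x <= j.+1%:R * h by case/andP: xj => ? ?; rewrite !ltW.
have pi0 := pi_gt0 R; have pi4 : pi < 4 :> R by have := pihalf_lt2 R; lra.
have /andP[x0 xpi] := x0pi.
have D0 : 0 <= C * h `^ r by rewrite mulr_ge0// powR_ge0.
(* [m] is at least a third of the distance to the end that the cell is assigned
   to, whichever it is. *)
pose m := Num.min x (pi - x).
have m0 : 0 <= m by rewrite /m minEle; case: ifP; lra.
have [e [e0 [E1 E2 eD]]] : exists e : R, 0 <= e /\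
    [/\ `|du t x - B| <= e,
        `|component u t x - (A + x * B)| <= e * m * 3 & e <= D].
  have [jL|jR] := leP (j.+1%:R * h) (3 / 4 * pi).
    exists (C * h `^ r * x `^ (- sg)); split; first by rewrite mulr_ge0// powR_ge0.
    have jn' : (j.+1 < n)%N by rewrite -(ltr_nat R) -(ltr_pM2r h0) nh; lra.
    have [||E1 E2] := mL h j h0 jL A B _ _ x xj.
    - by rewrite -vE ?vu ?lexx ?andbT// ltW.
    - rewrite -vE ?lexx ?(ltW jj)//; case: (j) jn => [|k] kn; last exact: vu.
      by rewrite mul0r component0.
    split => //; last by rewrite ler_wpM2l// /singular_weight lerDl powR_ge0.
    apply: le_trans E2 _; rewrite -[leRHS]mulrA ler_wpM2l ?mulr_ge0 ?powR_ge0//.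
    have xL : x <= 3 / 4 * pi by case/andP: xj' => _; move: jL; lra.
    by rewrite /m minEle; case: ifP; lra.
  exists (C * h `^ r * (pi - x) `^ (- sg)); split; first by rewrite mulr_ge0// powR_ge0.
  have j1 : j.+1%:R * h = j%:R * h + h by rewrite -natr1 mulrDl mul1r.
  have jgt : pi / 2 < j%:R * h by lra.
  have j0 : (0 < j)%N.
    by rewrite lt0n; apply/eqP => jE; move: jgt; rewrite jE mul0r; lra.
  have kE : (n - j.+1)%:R * h = pi - j.+1%:R * h by rewrite natrB// mulrBl nh.
  have kE' : (n - j.+1).+1%:R * h = pi - j%:R * h.
    by rewrite -natr1 mulrDl kE mul1r j1; ring.
  have xk : (n - j.+1)%:R * h < pi - x < (n - j.+1).+1%:R * h.
    by rewrite kE kE'; case/andP: xj; lra.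
  have kL : (n - j.+1).+1%:R * h <= 3 / 4 * pi by rewrite kE'; lra.
  have [||E1 E2] := mR h (n - j.+1)%N h0 kL (A + pi * B) (- B) _ _ (pi - x) xk.
  - rewrite kE' (_ : _ + _ * - B = A + (j%:R * h) * B); last by ring.
    rewrite -vE ?lexx ?(ltW jj)// vu ?j0//; congr component; ring.
  - rewrite kE (_ : _ + _ * - B = A + (j.+1%:R * h) * B); last by ring.
    rewrite -vE ?lexx ?(ltW jj)//.
    case E : (n - j.+1)%N => [|k].
      have -> : j.+1%:R * h = pi by move: kE; rewrite E mul0r; lra.
      exact: component0.
    rewrite vu; last by rewrite /= -(subn_gt0 j.+1 n) E.
    by congr component; ring.
  rewrite (_ : pi - (pi - x) = x) in E1 E2; last by ring.
  split.
  - by rewrite -normrN opprD.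
  - rewrite (_ : A + x * B = A + pi * B + (pi - x) * - B); last by ring.
    apply: le_trans E2 _; rewrite -[leRHS]mulrA ler_wpM2l ?mulr_ge0 ?powR_ge0//.
    have xR : pi - x <= 3 / 4 * pi by case/andP: xk => _ /ltW; move: kL; lra.
    by rewrite /m minEle; case: ifP; lra.
  - by rewrite ler_wpM2l// /singular_weight lerDr powR_ge0.
rewrite du_x dv vE//; split; first exact: le_trans eD.
- have m2 : m <= 2 by rewrite /m minEle; case: ifP; lra.
  by apply: le_trans E2 _; nra.
- have W0 : 0 <= 1 / x + 1 / (pi - x) by rewrite addr_ge0// divr_ge0// ?subr_ge0 ltW.
  apply: le_trans (ler_wpM2l W0 E2) _.
  have Wm : (1 / x + 1 / (pi - x)) * m <= 2.
    have mx : 1 / x * m <= 1 by rewrite mulrAC ler_pdivrMr// !mul1r /m ge_min lexx.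
    have mpx : 1 / (pi - x) * m <= 1.
      by rewrite mulrAC ler_pdivrMr ?subr_gt0// !mul1r /m ge_min lexx orbT.
    by rewrite mulrDl; lra.
  by have := ler_wpM2l e0 Wm; lra.
Qed.

Lemma sum_sqr_component_le u (x D : R) : 0 <= D ->
  (forall t, `|component u t x| <= D) ->
  \sum_(i < 2) complex.Re `|u x i ord0| ^+ 2 <= (2 * D) ^+ 2.
Proof.
move=> D0 H; rewrite sum_sqr_component.
have sq t : component u t x ^+ 2 <= D ^+ 2.
  by rewrite -(real_normK (num_real (component u t x))) lerXn2r ?nnegrE.
by rewrite sum_bool2 !big_bool /=; have := sq (true, true); have := sq (true, false);
  have := sq (false, true); have := sq (false, false); lra.
Qed.

Lemma component_diff_expr_le kappa V u v (x D K : R) t : 0 < x < pi ->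
  0 <= D -> 0 <= K -> (forall i j b, `|part b (V x%:C i j)| <= K) ->
  (forall t, `|derive1 (component u t) x - derive1 (component v t) x| <= D) ->
  (forall t, `|component u t x - component v t x| <= 6 * D) ->
  (forall t, (1 / x + 1 / (pi - x)) * `|component u t x - component v t x| <= 6 * D) ->
  `|component (fun y => diff_expr kappa V u y - diff_expr kappa V v y) t x| <=
  (1 + 6 * `|kappa| + 24 * K) * D.
Proof.
move=> x0pi D0 K0 VK Hd He Hw; rewrite componentB; case: t => i b.
rewrite /component -/(part _ _) /= !part_diff_expr//.
set W := 1 / x + 1 / (pi - x) in Hw *.
have W0 : 0 <= W.
  by rewrite addr_ge0// divr_ge0//; case/andP: x0pi => ? ?; rewrite ?subr_ge0 ltW.
pose e t := component u t x - component v t x.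
pose me j b' := mul_entry b b' (V x%:C (row_index i) (row_index j)).
have -> : (-1) ^+ i * (component u (~~ i, b))^`()%classic x +
    kappa * W * component u (~~ i, b) x +
    \sum_(j : bool) \sum_(b' : bool) me j b' * component u (j, b') x -
    ((-1) ^+ i * (component v (~~ i, b))^`()%classic x +
    kappa * W * component v (~~ i, b) x +
    \sum_(j : bool) \sum_(b' : bool) me j b' * component v (j, b') x) =
  (-1) ^+ i * (derive1 (component u (~~ i, b)) x - derive1 (component v (~~ i, b)) x) +
  kappa * (W * e (~~ i, b)) +
  \sum_(j : bool) \sum_(b' : bool) me j b' * e (j, b').
  by rewrite !big_bool /e /=; ring.
rewrite [leRHS]mulrDl [X in _ <= X + _]mulrDl; apply: le_trans (ler_normD _ _) _; rewrite lerD//.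
  apply: le_trans (ler_normD _ _) _; rewrite lerD//.
    by rewrite normrM normr_sign !mul1r.
  by rewrite normrM -mulrA (mulrCA 6) ler_wpM2l// normrM (ger0_norm W0) Hw.
have term j b' : `|me j b' * e (j, b')| <= K * (6 * D).
  by rewrite normrM norm_mul_entry ler_pM// ?VK// He.
have four (a1 a2 a3 a4 M : R) : `|a1| <= M -> `|a2| <= M -> `|a3| <= M -> `|a4| <= M ->
    `|a1 + a2 + (a3 + a4)| <= 4 * M.
  move=> h1 h2 h3 h4; apply: le_trans (ler_normD _ _) _.
  by have := ler_normD a1 a2; have := ler_normD a3 a4; lra.
rewrite !big_bool /= (_ : 24 * K * D = 4 * (K * (6 * D))); last by ring.
by apply: four; exact: term.
Qed.

Lemma interp_error_rate kappa V lambda u (r sg : R) :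
  analytic_hermitian_potential V -> in_dom kappa V u ->
  diff_expr kappa V u = (fun x => lambda *: u x)
    %[ae (@lebesgue_measure R) in `]0, pi[%classic] ->
  1 / 2 < `|kappa| -> 0 <= sg < 1 / 2 -> admissible_rate `|kappa| r sg ->
  exists c : R, 0 < c /\ forall n, (4 <= n)%N ->
    forall v, nodal_interpolant n u v ->
      (interp_error kappa V u v <= (c * (pi / n%:R) `^ r)%:E)%E.
Proof.
move=> anV domu heig k2 sg2 rate; have [_ acu _] := domu.
have [C C0 HC] := eigenfunction_mesh_error anV domu heig k2 rate.
have du := eigenfunction_system anV acu heig.
have [K K0 HK] := potential_lipschitz anV.
have [W W0 HW] := L2norm_le_weight sg2.
pose Q : R := 1 + 6 * `|kappa| + 24 * K.
have Q0 : 0 <= Q by rewrite /Q !addr_ge0// mulr_ge0.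
have c00 : 0 <= W * (2 * 6 * C) + W * (2 * Q * C) by rewrite addr_ge0 ?mulr_ge0.
exists (W * (2 * 6 * C) + W * (2 * Q * C) + 1); split; first by rewrite ltr_wpDl.
move=> n n4 v nodal; set hr := (pi / n%:R) `^ r.
have hr0 : 0 <= hr by exact: powR_ge0.
have cN : countable (range (@node R n)) by exact: card_image_le.
pose D x := C * hr * singular_weight sg x.
have D0 x : 0 <= D x by rewrite !mulr_ge0 ?singular_weight_ge0.
have err x t : 0 < x < pi -> ~ range (@node R n) x -> _ :=
  fun xpi xN => component_error C0 n4 nodal xpi xN (du t) (HC t).1 (HC t).2.
apply: (@le_trans _ _ ((W * (2 * 6 * C * hr))%:E + (W * (2 * Q * C * hr))%:E)%E).
  apply: leeD; apply: (HW _ _ _ cN); rewrite ?mulr_ge0// => x x0pi xN.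
  - rewrite (_ : _ * singular_weight sg x = 2 * (6 * D x)); last by rewrite /D; ring.
    apply: (@sum_sqr_component_le (fun y => u y - v y)) => [|t];
      first by rewrite mulr_ge0.
    by rewrite componentB; have [] := err x t x0pi xN.
  - rewrite (_ : _ * singular_weight sg x = 2 * (Q * D x)); last by rewrite /D; ring.
    apply: (@sum_sqr_component_le
      (fun y => diff_expr kappa V u y - diff_expr kappa V v y)) => [|t];
      first by rewrite mulr_ge0.
    apply: component_diff_expr_le => //.
    + move=> i j b; have [H _] := HK i j b; apply: H.
      by case/andP: x0pi => ? ?; rewrite !ltW.
    + by move=> t'; have [] := err x t' x0pi xN.
    + by move=> t'; have [] := err x t' x0pi xN.
    + by move=> t'; have [] := err x t' x0pi xN.
by rewrite -EFinD lee_fin; lra.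
Qed.

End InterpolationError.

Theorem theorem12 (R : realType) (kappa : R) (V : R[i] -> 'M[R[i]]_2)
  (hV : analytic_hermitian_potential V)
  (hkappa : 1 / 2 < `|kappa|)
  (lambda : R[i]) (hlambda : in_spec kappa V lambda)
  (u : R -> 'cV[R[i]]_2) (hu : in_dom kappa V u)
  (heig : diff_expr kappa V u = (fun x => lambda *: u x)
          %[ae (@lebesgue_measure R) in `]0, pi[%classic])
  (hnorm : L2norm u = 1%E) :
  (3 / 2 < `|kappa| \/ `|kappa| = 1 ->
     exists c : R, 0 < c /\
       forall n : nat, (4 <= n)%N ->
       forall uh : R -> 'cV[R[i]]_2, nodal_interpolant n u uh ->
         (interp_error kappa V u uh <= (c * (pi / n%:R))%:E)%E) /\
  (1 / 2 < `|kappa| -> `|kappa| <= 3 / 2 -> `|kappa| <> 1 ->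
     forall r : R, r < `|kappa| - 1 / 2 ->
     exists c : R, 0 < c /\
       forall n : nat, (4 <= n)%N ->
       forall uh : R -> 'cV[R[i]]_2, nodal_interpolant n u uh ->
         (interp_error kappa V u uh <= (c * (pi / n%:R) `^ r)%:E)%E).
Proof.
have h0 (n : nat) : (4 <= n)%N -> 0 < pi / n%:R :> R.
  by move=> n4; rewrite divr_gt0 ?pi_gt0// ltr0n; exact: leq_trans n4.
split.
  move=> kappa_range.
  have [sg sg2 rate] : exists2 sg : R, 0 <= sg < 1 / 2 & admissible_rate `|kappa| 1 sg.
    case: kappa_range => [k32|k1]; last first.
      by exists 0; [rewrite lexx divr_gt0|right].
    (* For [`|kappa| >= 2] the derivatives are Lipschitz up to the ends, and the
       weight is constant. *)
    exists (Num.max 0 (2 - `|kappa|)).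
      by rewrite maxEle; case: ifP; lra.
    by left; split; rewrite ?maxEle; try case: ifP; lra.
  have [c [c0 Hc]] := interp_error_rate hV hu heig hkappa sg2 rate.
  exists c; split => // n n4 uh nodal.
  by have := Hc n n4 uh nodal; rewrite powRr1// ltW// h0.
move=> _ k32 _ r rk.
(* Too small a rate would make [sg] negative; increasing it below the threshold
   strengthens the claim, as the mesh widths are bounded. *)
pose r' := Num.max r (Num.max 0 (`|kappa| - 1)).
have [rr' r'0 r'k r'1] :
    [/\ r <= r', 0 <= r', `|kappa| - 1 <= r' & r' < `|kappa| - 1 / 2].
  by rewrite /r' !le_max !gt_max !lexx !orbT; split => //; lra.
have sg2 : 0 <= r' + 1 - `|kappa| < 1 / 2 by lra.
have rate : admissible_rate `|kappa| r' (r' + 1 - `|kappa|) by left; split; lra.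
have [c [c0 Hc]] := interp_error_rate hV hu heig hkappa sg2 rate.
exists (c * pi `^ (r' - r)); split; first by rewrite mulr_gt0// powR_gt0// pi_gt0.
move=> n n4 uh nodal; apply: le_trans (Hc n n4 uh nodal) _.
rewrite lee_fin -mulrA ler_pM2l//; apply: ler_powR_exp => //; first exact: h0.
rewrite ler_pdivrMr ?ltr0n ?(leq_trans _ n4)// ler_peMr ?pi_ge0//.
by rewrite ler1n (leq_trans _ n4).
Qed.
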